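(* Let $\pi$ be an irreducible permutation on a finite alphabet $\mathcal{A}$. Then the action of the Rauzy monoid $\Pi(\pi)$ on the space of Lagrangian flags $\mathcal{L}(H(\pi))$, given by $\gamma\cdot h=\Theta(\gamma)h$, is minimal: the only nonempty closed subset $C\subset\mathcal{L}(H(\pi))$ with $\Theta(\gamma)\cdot C=C$ for all $\gamma\in\Pi(\pi)$ is $\mathcal{L}(H(\pi))$ itself.
   Context: A permutation is a pair $\pi=(\pi_0,\pi_1)$ of bijections $\mathcal{A}\to\{1,\dots,d\}$, $d=\#\mathcal{A}\ge2$; it is irreducible if there is no $1\le k<d$ with $\pi_0^{-1}(\{1,\dots,k\})=\pi_1^{-1}(\{1,\dots,k\})$. $\Omega(\pi)$ is the operator on $\mathbb{R}^{\mathcal{A}}$ with $\langle\Omega(\pi)e_x,e_y\rangle=1$ if $\pi_0(x)>\pi_0(y),\pi_1(x)<\pi_1(y)$; $-1$ if $\pi_0(x)<\pi_0(y),\pi_1(x)>\pi_1(y)$; $0$ otherwise. $H(\pi)=\Omega(\pi)\mathbb{R}^{\mathcal{A}}$, with symplectic form $\omega_\pi(\Omega(\pi)u,\Omega(\pi)v)=\langle u,\Omega(\pi)v\rangle$, $\dim H(\pi)=2g$. Rauzy operations: with $x,y$ the last letters of top and bottom rows, the top operation moves $y$ in the bottom row to just right of $x$ (winner $x$, loser $y$), the bottom operation moves $x$ in the top row to just right of $y$ (winner $y$, loser $x$). The Rauzy diagram has arrows from $\pi$ to these images; $\Pi(\pi)$ is the monoid (under concatenation) of paths starting and ending at $\pi$.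 For an arrow with winner $w$ and loser $\ell$, $\Theta(\gamma)e_w=e_w+e_\ell$, $\Theta(\gamma)e_z=e_z$ otherwise, and $\Theta(\gamma_1\gamma_2)=\Theta(\gamma_2)\Theta(\gamma_1)$; for $\gamma\in\Pi(\pi)$, $\Theta(\gamma)$ is a symplectic automorphism of $(H(\pi),\omega_\pi)$. A Lagrangian flag is a sequence $(F_i)_{i=1}^g$ of subspaces with $\dim F_i=i$, $F_i\subset F_{i+1}$, each $F_i$ isotropic ($\omega_\pi$ vanishes on $F_i$). *)

(* Defs.v *)
From HB Require Import structures.
From mathcomp Require Import all_boot all_order all_algebra.
From mathcomp Require Import classical_sets reals topology normedtype sequences.
Set Implicit Arguments. Unset Strict Implicit. Unset Printing Implicit Defensive.
Import Order.TTheory GRing.Theory Num.Theory numFieldNormedType.Exports.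

Section Rauzy.
Variable A : finType.

(* A permutation: pair (pi0, pi1) of maps A -> positions {1,..,d}, d = #|A|. *)
Definition rperm := ({ffun A -> nat} * {ffun A -> nat})%type.

Definition valid_perm (p : rperm) : Prop :=
  [/\ injective p.1, injective p.2 &
      forall x, (1 <= p.1 x <= #|A|) && (1 <= p.2 x <= #|A|)].

Definition irreducible (p : rperm) : Prop :=
  ~ (exists k : nat, (1 <= k < #|A|) /\ forall x : A, (p.1 x <= k) = (p.2 x <= k)).

Definition last_top (p : rperm) : option A := [pick x | p.1 x == #|A|].
Definition last_bot (p : rperm) : option A := [pick y | p.2 y == #|A|].

(* (winner, loser) of the top (b = true) / bottom (b = false) operation *)
Definition winner_loser (b : bool) (p : rperm) : option (A * A) :=
  match last_top p, last_bot p with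
  | Some x, Some y => Some (if b then (x, y) else (y, x))
  | _, _ => None
  end.

Definition insert_after (r : {ffun A -> nat}) (w l : A) : {ffun A -> nat} :=
  [ffun z => if z == l then (r w).+1
             else if r w < r z then (r z).+1 else r z].

Definition rauzy (b : bool) (p : rperm) : rperm :=
  match winner_loser b p with
  | Some (w, l) => if b then (p.1, insert_after p.2 w l)
                   else (insert_after p.1 w l, p.2)
  | None => p
  end.

(* a path in the Rauzy diagram starting at p = a sequence of operations *)
Definition endpoint (p : rperm) (s : seq bool) : rperm :=
  foldl (fun q b => rauzy b q) p s.

Definition rauzy_monoid (p : rperm) (s : seq bool) : Prop := endpoint p s = p.

Variable R : realType.
Local Open Scope ring_scope.

(* Vectors of R^A are row vectors 'rV_#|A|, e_x = delta at enum_rank x;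
   a linear operator T is the matrix M with u |-> u *m M, i.e. row x of M is T e_x. *)
Definition elem_mx (w l : A) : 'M[R]_#|A| :=
  1%:M + delta_mx (enum_rank w) (enum_rank l).

Definition arrow_mx (p : rperm) (b : bool) : 'M[R]_#|A| :=
  match winner_loser b p with
  | Some (w, l) => elem_mx w l
  | None => 1%:M
  end.

(* Theta(gamma1 gamma2) = Theta(gamma2) Theta(gamma1) as operators, i.e. the
   product of matrices in path order for the row-vector convention *)
Fixpoint Theta (p : rperm) (s : seq bool) : 'M[R]_#|A| :=
  match s with
  | [::] => 1%:M
  | b :: s' => arrow_mx p b *m Theta (rauzy b p) s'
  end.

(* Omega(p): entry (x,y) is <Omega e_x, e_y> *)
Definition Omega_mx (p : rperm) : 'M[R]_#|A| :=
  \matrix_(i, j)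
    (let x := enum_val i in let y := enum_val j in
     if ((p.1 y < p.1 x)%N && (p.2 x < p.2 y)%N) then 1
     else if ((p.1 x < p.1 y)%N && (p.2 y < p.2 x)%N) then -1 else 0).

Definition Hspace (p : rperm) : {vspace 'rV[R]_#|A|} :=
  (linfun (mulmxr (Omega_mx p)) @: fullv)%VS.

(* omega(Omega u, Omega v) = <u, Omega v>: for a in H, u := a *m pinvmx Omega
   satisfies u *m Omega = a *)
Definition omega (p : rperm) (a b : 'rV[R]_#|A|) : R :=
  (a *m pinvmx (Omega_mx p) *m b^T) 0 0.

Definition genus (p : rperm) : nat := (\rank (Omega_mx p)) %/ 2.

(* a flag (F_1, ..., F_g), F_(i+1) stored at index i : 'I_g *)
Definition flag (p : rperm) := {ffun 'I_(genus p) -> {vspace 'rV[R]_#|A|}}.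

Definition lagflag (p : rperm) (F : flag p) : Prop :=
  [/\ forall i, \dim (F i) = i.+1 :> nat,
      forall i j : 'I_(genus p), (i <= j)%N -> (F i <= F j)%VS,
      forall i, (F i <= Hspace p)%VS &
      forall i u v, u \in F i -> v \in F i -> omega p u v = 0].

Definition frame (p : rperm) (b : 'I_(genus p) -> 'rV[R]_#|A|) (F : flag p) : Prop :=
  forall i, F i = <<[seq b j | j : 'I_(genus p) <- enum 'I_(genus p) & (j <= i)%N]>>%VS.

(* convergence of flags (quotient topology of adapted frames) *)
Definition flag_cvg (p : rperm) (Fs : nat -> flag p) (F : flag p) : Prop :=
  exists (bs : nat -> 'I_(genus p) -> 'rV[R]_#|A|) (b : 'I_(genus p) -> 'rV[R]_#|A|),
    [/\ forall k, frame (bs k) (Fs k), frame b F &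
        forall i j, ((fun k => bs k i 0 j) @ \oo --> b i 0 j)%classic].

Definition lag_closed (p : rperm) (C : flag p -> Prop) : Prop :=
  forall (Fs : nat -> flag p) (F : flag p),
    (forall k, C (Fs k)) -> lagflag F -> flag_cvg Fs F -> C F.

Definition act (p : rperm) (M : 'M[R]_#|A|) (F : flag p) : flag p :=
  [ffun i => (linfun (mulmxr M) @: F i)%VS].

End Rauzy.

(* Main.v *)
Require Import Defs.
From HB Require Import structures.
From mathcomp Require Import all_boot all_order all_algebra.
From mathcomp Require Import boolp classical_sets reals topology normedtype sequences.
From mathcomp Require Import zify ring lra.

(** The invariance of [C] under [Theta(s)] for the loops [s] at [p] makes it
    invariant under the group they generate. Let [Om] be the matrix of
    Omega(p) and [a_x = Om e_x]. Repeating one Rauzy operation turns a row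
    around and gives a loop whose matrix is the transvection along [a_w], [w]
    being the winner. Every letter [x] becomes last along some path before
    having ever been a loser; conjugating by this path shows that the
    transvections along all the vectors [a_x] preserve [C].

    The vectors [a_x] span [H], their pairings are 0, 1 or -1, and irreducibility
    means that the graph of nonzero pairings is connected. Hence the lines
    spanned by vectors whose transvections preserve [C] are dense in [H]: a
    plane [<a_x, a_y>] with pairing 1 or -1 is reached by the Euclidean
    algorithm, and a subspace of limit lines which is not isotropic can be
    enlarged by any vector [a_z] that is not orthogonal to it.

    For [w] in [H] not orthogonal to [F_1], it follows that [C] contains, with
    [F], the flag [F_i' = <w> + F_i :&: w^perp]. This operation can be undone
    and ignores real transvections along [w], so [C] is preserved by all real
    symplectic transvections, and these act transitively on Lagrangian flags. *)

Set Implicit Arguments. Unset Strict Implicit. Unset Printing Implicit Defensive.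
Import Order.TTheory GRing.Theory Num.Theory numFieldNormedType.Exports.

(** * Coordinatewise limits of row vectors *)

Section VectorLimits.
Local Open Scope ring_scope.
Local Open Scope classical_set_scope.
Variables (R : realType) (n : nat).
Local Notation V := 'rV[R]_n.

Definition cvg_rV (x : nat -> V) (l : V) :=
  forall j, (fun k => x k 0 j) @ \oo --> l 0 j.

Lemma cvg_rV_cst (l : V) : cvg_rV (fun=> l) l.
Proof. by move=> j; exact: cvg_cst. Qed.

Lemma cvg_rVD (x y : nat -> V) l m : cvg_rV x l -> cvg_rV y m ->
  cvg_rV (fun k => x k + y k) (l + m).
Proof.
move=> hx hy j; rewrite mxE.
under eq_fun do rewrite mxE.
by apply: cvgD; [exact: hx | exact: hy].
Qed.

Lemma cvg_rVZ (c : nat -> R) (x : nat -> V) (a : R) l : c @ \oo --> a -> cvg_rV x l ->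
  cvg_rV (fun k => c k *: x k) (a *: l).
Proof.
move=> hc hx j; rewrite mxE.
under eq_fun do rewrite mxE.
by apply: cvgM; [exact: hc | exact: hx].
Qed.

Lemma cvg_rV_mx (x : nat -> V) l (M : 'M[R]_n) : cvg_rV x l ->
  cvg_rV (fun k => x k *m M) (l *m M).
Proof.
move=> hx j; rewrite mxE.
under eq_fun do rewrite mxE.
apply: (@cvg_big _ _ +%R) => // [|i _]; first exact: add_continuous.
by apply: cvgM; [exact: hx | exact: cvg_cst].
Qed.

Lemma cvg_dot (x y : nat -> V) l m : cvg_rV x l -> cvg_rV y m ->
  (fun k => (x k *m (y k)^T) 0 0) @ \oo --> (l *m m^T) 0 0.
Proof.
move=> hx hy; rewrite mxE.
under eq_fun do rewrite mxE.
apply: (@cvg_big _ _ +%R) => // [|i _]; first exact: add_continuous.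
rewrite mxE; under eq_fun do rewrite mxE.
by apply: cvgM; [exact: hx | exact: hy].
Qed.

Lemma cvg_inv_nat (a : R) : (fun k => a / k.+1%:R) @ \oo --> (0 : R).
Proof.
rewrite -[X in _ --> X](mulr0 a); apply: cvgM; first exact: cvg_cst.
exact: cvg_harmonic.
Qed.
End VectorLimits.

(** * The symplectic form and its transvections *)

Section SymplecticForm.
Local Open Scope ring_scope.
Local Open Scope classical_set_scope.
Variables (R : realType) (n : nat) (Om : 'M[R]_n).
Hypothesis skew_Om : Om^T = - Om.
Local Notation V := 'rV[R]_n.

(** The formula of [omega] for an abstract skew matrix, which separates the dynamics on flags from
    the combinatorics of permutations. *)
Definition sform (u v : V) : R := (u *m pinvmx Om *m v^T) 0 0.
Local Notation inH u := (submx (u%R : V) Om).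

Lemma sformDl u v w : sform (u + v) w = sform u w + sform v w.
Proof. by rewrite /sform !mulmxDl mxE. Qed.
Lemma sformDr u v w : sform w (u + v) = sform w u + sform w v.
Proof. by rewrite /sform linearD /= mulmxDr mxE. Qed.
Lemma sformZl a u w : sform (a *: u) w = a * sform u w.
Proof. by rewrite /sform -!scalemxAl mxE. Qed.
Lemma sformZr a u w : sform w (a *: u) = a * sform w u.
Proof. by rewrite /sform linearZ /= -scalemxAr mxE. Qed.
Lemma sformNl u w : sform (- u) w = - sform u w.
Proof. by rewrite -scaleN1r sformZl mulN1r. Qed.
Lemma sformNr u w : sform w (- u) = - sform w u.
Proof. by rewrite -scaleN1r sformZr mulN1r. Qed.
Lemma sform0r w : sform w 0 = 0.
Proof. by rewrite -(scale0r w) sformZr mul0r. Qed.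
Definition sformE := (sformDl, sformDr, sformNl, sformNr, sformZl, sformZr).

(** Skew-symmetry puts a factor [Om] to the right of [pinvmx Om], and [Om *m pinvmx Om *m Om = Om];
    so the preimage picked by the pseudo-inverse does not matter. *)
Lemma sform_dot a v : inH v -> sform (a *m Om) v = (a *m v^T) 0 0.
Proof.
move=> /submxP[c ->]; rewrite /sform; congr (fun M : 'M_1 => M 0 0).
rewrite trmx_mul skew_Om mulNmx !mulmxN [_ *m pinvmx _ *m _]mulmxA.
by rewrite mulmxKpV ?submxMl // mulmxA.
Qed.

Lemma sform_skew u v : inH u -> inH v -> sform v u = - sform u v.
Proof.
move=> hu hv; have /submxP[a ea] := hu; have /submxP[c ec] := hv.
rewrite {1}ec {2}ea !sform_dot // ea ec.
have -> : c *m (a *m Om)^T = - (a *m (c *m Om)^T)^T.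
  by rewrite [in RHS]trmx_mul trmxK [in LHS]trmx_mul skew_Om mulNmx mulmxN mulmxA.
by rewrite mxE [in LHS]mxE.
Qed.

Lemma sform_self u : inH u -> sform u u = 0.
Proof. by move=> hu; have := sform_skew hu hu; lra. Qed.

Lemma inHD u v : inH u -> inH v -> inH (u + v).
Proof. exact: addmx_sub. Qed.
Lemma inHZ a u : inH u -> inH (a *: u).
Proof. exact: scalemx_sub. Qed.
Lemma inHB u v : inH u -> inH v -> inH (u - v).
Proof. by move=> hu hv; apply: inHD => //; rewrite -scaleN1r; apply: inHZ. Qed.

Lemma cvg_sform (x y : nat -> V) l m : cvg_rV x l -> cvg_rV y m ->
  (fun k => sform (x k) (y k)) @ \oo --> sform l m.
Proof. by move=> hx hy; apply: cvg_dot => //; apply: cvg_rV_mx. Qed.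

Definition transv (u : V) (s : R) (v : V) : V := v + (s * sform u v) *: u.

Lemma transvD u s x y : transv u s (x + y) = transv u s x + transv u s y.
Proof. by rewrite /transv sformE mulrDr scalerDl addrACA. Qed.
Lemma transvZ u s a x : transv u s (a *: x) = a *: transv u s x.
Proof. by rewrite /transv sformE scalerDr scalerA mulrCA. Qed.

Lemma inH_transv u s v : inH u -> inH v -> inH (transv u s v).
Proof. by move=> hu hv; apply: inHD => //; apply: inHZ. Qed.

Lemma sform_transv u s x y : inH u -> inH x -> inH y ->
  sform (transv u s x) (transv u s y) = sform x y.
Proof.
move=> hu hx hy; rewrite /transv !sformE (sform_self hu) (sform_skew hu hx).
ring.
Qed.

Lemma transv_add u s t x : inH u -> transv u s (transv u t x) = transv u (s + t) x.
Proof.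
move=> hu; rewrite /transv !sformE (sform_self hu) !mulr0 addr0 -addrA -scalerDl.
by congr (_ + _ *: _); ring.
Qed.

Lemma transv0 u x : transv u 0 x = x.
Proof. by rewrite /transv mul0r scale0r addr0. Qed.

Lemma transvB u s x y : transv u s (x - y) = transv u s x - transv u s y.
Proof. by rewrite -scaleN1r transvD transvZ scaleN1r. Qed.

Lemma transv0r u s : transv u s 0 = 0.
Proof. by rewrite /transv sform0r mulr0 scale0r addr0. Qed.

Lemma transvK u s x : inH u -> transv u (- s) (transv u s x) = x.
Proof. by move=> hu; rewrite transv_add // addNr transv0. Qed.

(** A symplectic map conjugates the transvection along [v] into the one along the image of [v]; here
    the map is itself a transvection. *)
Lemma transv_conj u s v t x : inH u -> inH v -> inH x ->
  transv (transv u s v) t x = transv u s (transv v t (transv u (- s) x)).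
Proof.
move=> hu hv hx; rewrite [transv v t _]/transv transvD transvZ.
rewrite -{2}(opprK s) transvK // [LHS]/transv; congr (_ + (_ * _) *: _).
rewrite /transv !sformE (sform_skew hu hv); ring.
Qed.
End SymplecticForm.

(** * Flags and frames *)

Section Flags.
Local Open Scope ring_scope.
Local Open Scope classical_set_scope.
Variables (R : fieldType) (n g : nat).
Local Notation V := 'rV[R]_n.
Implicit Types b : 'I_g -> V.

Definition Flag b : {ffun 'I_g -> {vspace V}} :=
  [ffun i : 'I_g => <<[seq b j | j : 'I_g <- enum 'I_g & (j <= i)%N]>>%VS].

Lemma mem_Flag b (i j : 'I_g) : (j <= i)%N -> b j \in Flag b i.
Proof.
move=> ji; rewrite ffunE; apply: memv_span; apply: map_f.
by rewrite mem_filter ji mem_enum.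
Qed.

Lemma Flag_sub b (U : {vspace V}) (i : 'I_g) :
  (forall j : 'I_g, (j <= i)%N -> b j \in U) -> (Flag b i <= U)%VS.
Proof.
move=> hU; rewrite ffunE; apply/span_subvP => v /mapP[j].
by rewrite mem_filter => /andP[ji _] ->; apply: hU.
Qed.

Lemma FlagS b (i j : 'I_g) : (i <= j)%N -> (Flag b i <= Flag b j)%VS.
Proof. by move=> ij; apply: Flag_sub => k ki; apply/mem_Flag/(leq_trans ki). Qed.

Lemma eq_Flag b b' : (forall j, b' j \in Flag b j) -> (forall j, b j \in Flag b' j) ->
  Flag b' = Flag b.
Proof.
move=> h h'; apply/ffunP => i; apply/eqP; rewrite eqEsubv.
by apply/andP; split; apply: Flag_sub => j /FlagS/subvP; apply.
Qed.

Lemma Flag_lin (f : 'End(V)) b : [ffun i : 'I_g => (f @: Flag b i)%VS] = Flag (f \o b).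
Proof.
apply/ffunP => i; rewrite !ffunE limg_span; congr <<_>>%VS.
by rewrite -map_comp.
Qed.

Definition frame_mx b : 'M[R]_(g, n) := \matrix_i b i.

Lemma mul_frame_mx b (v : 'rV_g) : v *m frame_mx b = \sum_i v 0 i *: b i.
Proof. by rewrite mulmx_sum_row; apply: eq_bigr => i _; rewrite rowK. Qed.

Lemma row_free_dual b : row_free (frame_mx b) ->
  forall j, exists a : V, forall i, (a *m (b i)^T) 0 0 = (i == j)%:R.
Proof.
move=> /row_freeP[X bX] j; exists (col j X)^T => i.
have := congr1 (fun M : 'M_g => M i j) bX; rewrite !mxE => <-.
by apply: eq_bigr => k _; rewrite !mxE mulrC.
Qed.

Lemma dim_Flag b i : row_free (frame_mx b) -> \dim (Flag b i) = i.+1.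
Proof.
move=> fb; rewrite ffunE.
have fX : free [seq b j | j <- enum 'I_g].
  have -> : [seq b j | j <- enum 'I_g] = mktuple b by [].
  apply/freeP => k k0 j.
  have : (\row_i k i) *m frame_mx b = 0.
    rewrite mul_frame_mx -[RHS]k0; apply: eq_bigr => l _.
    by rewrite mxE -tnth_nth tnth_mktuple.
  rewrite -(mul0mx _ (frame_mx b)) => /(row_free_inj fb)/rowP/(_ j).
  by rewrite !mxE.
have : free [seq b j | j : 'I_g <- enum 'I_g & (j <= i)%N].
  have inj : injective b.
    move=> x y e; have [a ha] := row_free_dual fb y.
    by have := ha x; rewrite e ha eqxx; case: eqP => // _ /eqP; rewrite oner_eq0.
  (* [filter_free] selects vectors, not indices; injectivity of [b] translates one selection into
     the other. *)
  have -> : [seq b j | j : 'I_g <- enum 'I_g & (j <= i)%N] =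
      [seq v <- [seq b j | j <- enum 'I_g] | [exists j : 'I_g, (j <= i)%N && (v == b j)]].
    rewrite [RHS]filter_map; congr (map _ _); apply: eq_filter => j /=.
    apply/idP/existsP => [ji|[k /andP[ki /eqP/inj ->]]] //.
    by exists j; rewrite ji eqxx.
  exact: filter_free.
move=> /eqP ->; rewrite size_map size_filter -(count_map val (fun j => j <= i)%N).
rewrite val_enum_ord -size_filter.
by rewrite (@filter_iota_leq g 0%N i (ltn_ord i)) size_iota.
Qed.

(** Choose [b i] nonzero in [F i] and outside all earlier subspaces. In a vanishing combination, the
    vector of largest index with nonzero coefficient would be zero or lie in the preceding
    subspace. *)
Lemma flag_has_frame (F : {ffun 'I_g -> {vspace V}}) :
  (forall i, \dim (F i) = i.+1) ->
  (forall i j : 'I_g, (i <= j)%N -> (F i <= F j)%VS) ->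
  exists2 b, row_free (frame_mx b) & Flag b = F.
Proof.
move=> dF mF.
have [b hb] : exists b : 'I_g -> V, forall i, [/\ b i \in F i, b i != 0 &
    forall j : 'I_g, (j < i)%N -> b i \notin F j].
  suff h : forall i, exists v : V, [/\ v \in F i, v != 0 &
      forall j : 'I_g, (j < i)%N -> v \notin F j].
    by have [b hb] := choice h; exists b.
  move=> i.
  have [[j /eqP ji]|ni] := pselect (exists j : 'I_g, j.+1 == i :> nat).
    have /subvPn[v vi vj] : ~~ (F i <= F j)%VS.
      by apply/negP => /dimvS; rewrite !dF -ji ltnn.
    exists v; split=> // [|k ki]; first by apply: contraNneq vj => ->; rewrite mem0v.
    by apply: contraNN vj => /(subvP (mF _ _ _)); apply; rewrite -ltnS ji.
  exists (vpick (F i)); split=> [||j ji].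
  - exact: memv_pick.
  - by rewrite vpick0; apply/eqP => F0; have := dF i; rewrite F0 dimv0.
  - case: ni; have i0 : (i.-1 < g)%N by case: (i) ji => -[|m] //= /ltnW.
    by exists (Ordinal i0) => /=; apply/eqP/prednK/(leq_ltn_trans _ ji).
have fb : row_free (frame_mx b).
  apply: inj_row_free => v; rewrite mul_frame_mx => v0.
  apply/eqP; apply/contraT => /eqP vN0.
  have /existsP[i0 hi0] : [exists i, v 0 i != 0].
    apply/contraT; rewrite negb_exists => /forallP h; case: vN0; apply/rowP => i.
    by rewrite mxE; apply/eqP; rewrite -[_ == _]negbK h.
  have [i vi imax] := @arg_maxnP _ i0 (fun i => v 0 i != 0) (fun i => val i) hi0.
  have [bi bi0 bij] := hb i.
  have ebi : b i = \sum_(j | j != i) (- (v 0 i)^-1 * v 0 j) *: b j.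
    have := v0; rewrite (bigD1 i) //= => /eqP; rewrite addr_eq0 => /eqP e.
    rewrite -[LHS]scale1r -(mulVf vi) -scalerA e scalerN -scaleNr scaler_sumr.
    by apply: eq_bigr => j _; rewrite scalerA.
  have small (j : 'I_g) : (j != i) -> (i <= j)%N -> v 0 j = 0.
    move=> ji ij; apply/eqP; rewrite -[_ == _]negbK; apply/negP => /imax /= ji'.
    by case/eqP: ji; apply/val_inj/eqP; rewrite /= eqn_leq; apply/andP.
  have [[k /eqP ki]|ni] := pselect (exists j : 'I_g, j.+1 == i :> nat).
    have ki' : (k < i)%N by rewrite -ki.
    case/negP: (bij k ki'); rewrite ebi; apply: memv_suml => j ji.
    have [ij|ij] := leqP i j; first by rewrite (small j) // mulr0 scale0r mem0v.
    apply/memvZ/(subvP (mF j k _)); first by rewrite -ltnS ki.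
    by have [] := hb j.
  case/eqP: bi0; rewrite ebi big1 // => j ji; have [ij|ij] := leqP i j.
    by rewrite (small j) // mulr0 scale0r.
  case: ni; have i0' : (i.-1 < g)%N by case: (i) ij => -[|m] //= /ltnW.
  by exists (Ordinal i0') => /=; apply/eqP/prednK/(leq_ltn_trans _ ij).
exists b => //; apply/ffunP => i; apply/eqP; rewrite eqEdim dim_Flag // dF leqnn andbT.
apply: Flag_sub => j ji; have [bj _ _] := hb j.
exact: subvP (mF _ _ ji) _ bj.
Qed.
End Flags.

(** * Closed sets of flags invariant under transvections *)

Section Minimality.
Local Open Scope ring_scope.
Local Open Scope classical_set_scope.
Variables (R : realType) (n g : nat) (Om : 'M[R]_n) (i0 : 'I_g).
Hypothesis skew_Om : Om^T = - Om.
Hypothesis i0E : i0 = 0%N :> nat.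
Local Notation V := 'rV[R]_n.
Local Notation inH u := (submx (u%R : V) Om).
Local Notation om := (sform Om).
Local Notation tv := (transv Om).
Implicit Types (b : 'I_g -> V) (u v w x y z : V).

Definition lag_frame b :=
  [/\ forall i, inH (b i), forall i j, om (b i) (b j) = 0 & row_free (frame_mx b)].

Lemma transv_sum u s (I : finType) (P : pred I) (F : I -> V) :
  tv u s (\sum_(i | P i) F i) = \sum_(i | P i) tv u s (F i).
Proof.
by apply: (big_morph _ (transvD Om u s)); rewrite transv0r.
Qed.

Lemma lag_frame_transv u s b : inH u -> lag_frame b -> lag_frame (tv u s \o b).
Proof.
move=> hu [hb ib fb]; split=> [i|i j|] /=.
- exact: inH_transv.
- by rewrite sform_transv.
apply: inj_row_free => v; rewrite mul_frame_mx.
under eq_bigr do rewrite -transvZ.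
rewrite -transv_sum -mul_frame_mx => /(congr1 (tv u (- s))).
rewrite transvK // transv0r.
by rewrite -(mul0mx _ (frame_mx b)); apply: row_free_inj.
Qed.

(** The vector [a *m Om] pairs with vectors of H as [a] does under the dot product, so the form
    realizes dual coordinates. *)
Lemma lag_frame_dual b j : lag_frame b ->
  exists z, inH z /\ forall i, om z (b i) = (i == j)%:R.
Proof.
move=> [hb _ fb]; have [a ha] := row_free_dual fb j.
by exists (a *m Om); split=> [|i]; [exact: submxMl | rewrite sform_dot].
Qed.

Variable C : {ffun 'I_g -> {vspace V}} -> Prop.
Definition frame_in b := lag_frame b /\ C (Flag b).
Hypothesis closedC : forall bs b, (forall k : nat, frame_in (bs k)) -> lag_frame b ->
  (forall i, cvg_rV (fun k => bs k i) (b i)) -> frame_in b.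

(** Both signs are required, so that such transvections can be conjugated by one another. *)
Definition preserving u := inH u /\
  forall b, frame_in b -> frame_in (tv u 1 \o b) /\ frame_in (tv u (-1) \o b).

Lemma preserving_sign u (s : R) b : preserving u -> s = 1 \/ s = -1 ->
  frame_in b -> frame_in (tv u s \o b).
Proof. by move=> [hu du] [->|->] /du[]. Qed.

Lemma preserving_transv u s v : s = 1 \/ s = -1 ->
  preserving u -> preserving v -> preserving (tv u s v).
Proof.
move=> hs du dv; have [hu _] := du; have [hv _] := dv.
have hNs : - s = 1 \/ - s = -1 by case: hs => ->; [right|left; rewrite opprK].
split; first exact: inH_transv.
have key t b : t = 1 \/ t = -1 -> frame_in b -> frame_in (tv (tv u s v) t \o b).
  move=> ht Cb; have [[hb _ _] _] := Cb.
  have -> : tv (tv u s v) t \o b =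
      tv u s \o (tv v t \o (tv u (- s) \o b)).
    by apply: funext => i /=; rewrite transv_conj.
  by do 3![apply: preserving_sign => //].
by move=> b Cb; split; apply: key => //; [left|right].
Qed.

Lemma preserving_nat u (m : nat) b : preserving u -> frame_in b -> frame_in (tv u m%:R \o b).
Proof.
move=> du Cb; have [hu _] := du; elim: m => [|m IH].
  by have -> : tv u 0%:R \o b = b by apply: funext => i /=; rewrite transv0.
have -> : tv u m.+1%:R \o b = tv u 1 \o (tv u m%:R \o b).
  by apply: funext => i /=; rewrite transv_add // -natr1 addrC.
by apply: preserving_sign => //; left.
Qed.

(* The limits of multiples of vectors whose transvections preserve [C]. *)
Definition limit_dir w := inH w /\ exists (us : nat -> V) (ls : nat -> R),
  (forall k, preserving (us k)) /\ cvg_rV (fun k => ls k *: us k) w.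

(** Diagonal extraction: the error [1/(k+1)] is split between a term [xs m] near [w] and a multiple
    of a preserving vector near [xs m], for all coordinates at once. *)
Lemma limit_dir_closed (xs : nat -> V) w : inH w -> (\forall k \near \oo, limit_dir (xs k)) ->
  cvg_rV xs w -> limit_dir w.
Proof.
move=> hw hK hx; split=> //.
suff h (k : nat) : exists p : V * R, preserving p.1 /\
    forall j, `|w 0 j - (p.2 *: p.1) 0 j| < k.+1%:R^-1.
  have [f hf] := choice h.
  exists (fun k => (f k).1), (fun k => (f k).2); split=> [k|j].
    by have [] := hf k.
  apply/cvgrPdist_lt => e e0; have /cvgrPdist_lt/(_ e e0) := @cvg_inv_nat R 1.
  apply: filterS => k; rewrite sub0r normrN ger0_norm ?divr_ge0 // div1r.
  by apply: lt_trans; have [_ /(_ j)] := hf k.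
have e0 : 0 < k.+1%:R^-1 / 2 :> R by rewrite divr_gt0 // invr_gt0.
have near_all (ys : nat -> V) (v : V) : cvg_rV ys v ->
    \forall m \near \oo, forall j, `|v 0 j - ys m 0 j| < k.+1%:R^-1 / 2.
  move=> hy; apply: filter_forall => j.
  by move/cvgrPdist_lt: (hy j); apply.
have [m [[_ [us [ls [dus hus]]]] xm]] := filter_ex (filterI hK (near_all _ _ hx)).
have [l xl] := filter_ex (near_all _ _ hus).
exists (us l, ls l); split=> //= j; have := ltrD (xm j) (xl j).
rewrite -splitr; apply: le_lt_trans.
exact: ler_distD.
Qed.

Lemma preserving_limit_dir u a : preserving u -> limit_dir (a *: u).
Proof.
move=> du; have [hu _] := du; split; first exact: inHZ.
by exists (fun=> u), (fun=> a); split=> //; exact: cvg_rV_cst.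
Qed.

Lemma limit_dir_scale a w : limit_dir w -> limit_dir (a *: w).
Proof.
move=> [hw [us [ls [du hus]]]]; split; first exact: inHZ.
exists us, (fun k => a * ls k); split=> //.
under eq_fun do rewrite -scalerA.
by apply: cvg_rVZ => //; exact: cvg_cst.
Qed.

Lemma cvg_transv (us xs : nat -> V) u x (ss : nat -> R) s : cvg_rV us u -> cvg_rV xs x ->
  ss @ \oo --> s -> cvg_rV (fun k => tv (us k) (ss k) (xs k)) (tv u s x).
Proof.
move=> hu hx hs; apply: cvg_rVD => //; apply: cvg_rVZ => //.
by apply: cvgM => //; exact: cvg_sform.
Qed.

Lemma limit_dir_transv u s w : s = 1 \/ s = -1 ->
  preserving u -> limit_dir w -> limit_dir (tv u s w).
Proof.
move=> hs du [hw [us [ls [dus hus]]]]; have [hu _] := du; split; first exact: inH_transv.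
exists (fun k => tv u s (us k)), ls; split=> [k|]; first exact: preserving_transv.
under eq_fun do rewrite -transvZ.
by apply: cvg_transv => //; [exact: cvg_rV_cst | exact: cvg_cst].
Qed.

Lemma limit_dir_transv_nat u (m : nat) w : preserving u -> limit_dir w -> limit_dir (tv u m%:R w).
Proof.
move=> du Kw; have [hu _] := du; elim: m => [|m IH]; first by rewrite transv0.
by rewrite -natr1 addrC -transv_add //; apply: limit_dir_transv => //; left.
Qed.

Lemma near_affine_neq0 (a c : R) : c != 0 -> \forall k \near \oo, a + c / k.+1%:R != 0.
Proof.
move=> c0; have [->|a0] := eqVneq a 0.
  by apply: nearW => k; rewrite add0r mulf_neq0 // invr_eq0 pnatr_eq0.
have : (fun k => a + c / k.+1%:R) @ \oo --> a + 0.
  by apply: cvgD; [exact: cvg_cst | exact: cvg_inv_nat].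
by rewrite addr0 => /cvgr_neq0; apply.
Qed.

Lemma cvg_floor (x : R) :
  (fun k => (Num.floor (k.+1%:R * x))%:~R / k.+1%:R) @ \oo --> x.
Proof.
apply/cvgrPdist_lt => e e0; have /cvgrPdist_lt/(_ e e0) := @cvg_inv_nat R 1.
apply: filterS => k; rewrite sub0r normrN ger0_norm ?divr_ge0 // div1r.
apply: le_lt_trans; have : 0 < k.+1%:R :> R by [].
move: (k.+1%:R : R) => d d0.
have := floor_le_tmp (d * x); have := floorD1_gt (d * x).
rewrite intrD; set f := _%:~R => h1 h2.
have -> : x - f / d = (d * x - f) / d by field; rewrite lt0r_neq0.
rewrite ger0_norm; last by rewrite divr_ge0 ?subr_ge0 // ltW.
rewrite ler_pdivrMr // mulVf; last exact: lt0r_neq0.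
lra.
Qed.

Lemma om_self u : inH u -> om u u = 0. Proof. exact: sform_self. Qed.

(** Integer combinations come from the Euclidean algorithm, run by induction on the sum of absolute
    values. Real coefficients are limits of integers over the common denominator [k+1], which
    scaling absorbs. *)
Lemma limit_dir_plane u v (x y : R) : preserving u -> preserving v -> om u v = 1 \/ om u v = -1 ->
  limit_dir (x *: u + y *: v).
Proof.
move=> du dv e1; have [hu _] := du; have [hv _] := dv.
have inv_sign (s : R) : s = 1 \/ s = -1 -> s * s = 1 by case=> ->; ring.
have ss := inv_sign _ e1.
have sgn2 (s t : R) : s = 1 \/ s = -1 -> t = 1 \/ t = -1 -> s * t = 1 \/ s * t = -1.
  by move=> [->|->] [->|->]; [left|right|right|left]; ring.
have pm (s : int) : s = 1 \/ s = -1 -> s%:~R = 1 :> R \/ s%:~R = -1 :> R.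
  by case=> ->; [left|right].
have ints N (m k : int) : (`|m| + `|k| <= N)%N -> limit_dir (m%:~R *: u + k%:~R *: v).
  elim: N m k => [|N IH] m k le_N.
    have [-> ->] : m = 0 /\ k = 0 by lia.
    by rewrite !scale0r addr0 -(scale0r u); apply: preserving_limit_dir.
  have [->|k0] := eqVneq k 0; first by rewrite scale0r addr0; apply: preserving_limit_dir.
  have [->|m0] := eqVneq m 0; first by rewrite scale0r add0r; apply: preserving_limit_dir.
  (* As both coefficients are nonzero, adding or subtracting the smaller one lowers the absolute
     value of the larger. *)
  have [[s [hs hm]]|[s [hs hk]]] :
      (exists s : int, (s = 1 \/ s = -1) /\ (`|(m - s * k)%R| + `|k| <= N)%N) \/
      (exists s : int, (s = 1 \/ s = -1) /\ (`|m| + `|(k - s * m)%R| <= N)%N).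
    have /orP[/orP[/orP[h|h]|h]|h] : ((`|(m - 1 * k)%R| + `|k| <= N) ||
        (`|(m - (-1) * k)%R| + `|k| <= N) || (`|m| + `|(k - 1 * m)%R| <= N) ||
        (`|m| + `|(k - (-1) * m)%R| <= N))%N by lia.
    - by left; exists 1; split=> //; left.
    - by left; exists (-1); split=> //; right.
    - by right; exists 1; split=> //; left.
    - by right; exists (-1); split=> //; right.
  (* With the power [s * om u v] the pairing appears squared, hence as 1, and the subtracted [s * k]
     is restored. *)
  - have := limit_dir_transv (sgn2 _ _ (pm _ hs) e1) du (IH _ _ hm).
    rewrite /transv !sformE om_self // intrB intrM.
    rewrite mulr0 add0r addrAC -scalerDl.
    have -> : m%:~R - s%:~R * k%:~R + s%:~R * om u v * (k%:~R * om u v) =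
      m%:~R - s%:~R * k%:~R + s%:~R * k%:~R * (om u v * om u v) :> R by ring.
    by rewrite ss mulr1 subrK.
  - have := limit_dir_transv (sgn2 (- s%:~R) _ _ e1) dv (IH _ _ hk).
    rewrite /transv !sformE om_self // (sform_skew skew_Om hu hv) intrB intrM.
    rewrite mulr0 addr0 -addrA -scalerDl.
    have -> : k%:~R - s%:~R * m%:~R + - s%:~R * om u v * (m%:~R * - om u v) =
      k%:~R - s%:~R * m%:~R + s%:~R * m%:~R * (om u v * om u v) :> R by ring.
    by rewrite ss mulr1 subrK; apply; case: (pm _ hs) => ->; [right|left; ring].
have hc (c : R) w : cvg_rV
    (fun k => ((Num.floor (k.+1%:R * c))%:~R / k.+1%:R) *: w) (c *: w).
  by apply: cvg_rVZ; [exact: cvg_floor | exact: cvg_rV_cst].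
apply: (limit_dir_closed _ _ (cvg_rVD (hc x u) (hc y v))).
  by apply: inHD; exact: inHZ.
apply: nearW => k; rewrite ![_ / _]mulrC -!scalerA -scalerDr.
by apply: limit_dir_scale; apply: (ints _ _ _ (leqnn _)).
Qed.

(* [T_u^k (z + c/k y)] tends to [z + (c om u y) u]: letting [k] grow turns the
   discrete transvection into a real one, at the cost of perturbing [z]. *)
Lemma limit_dir_shear_preserving u z y s : preserving u -> (forall c, limit_dir (z + c *: y)) ->
  om u z = 0 -> om u y != 0 -> limit_dir (z + s *: u).
Proof.
move=> du hz uz uy; have [hu _] := du.
have [hz0 _] := hz 0; rewrite scale0r addr0 in hz0.
pose c := s / om u y.
pose xs k := tv u k.+1%:R (z + (c / k.+1%:R) *: y).
have xsE k : xs k = z + (c / k.+1%:R) *: y + s *: u.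
  rewrite /xs /transv !sformE uz add0r; congr (_ + _ *: _).
  have : k.+1%:R != 0 :> R by rewrite pnatr_eq0.
  by rewrite /c; move: (k.+1%:R : R) => d d0; field; apply/andP.
have hx : cvg_rV xs (z + 0 *: y + s *: u).
  rewrite (funext xsE); apply: cvg_rVD; last exact: cvg_rV_cst.
  apply: cvg_rVD; first exact: cvg_rV_cst.
  by apply: cvg_rVZ; [exact: cvg_inv_nat | exact: cvg_rV_cst].
rewrite scale0r addr0 in hx.
apply: (limit_dir_closed _ _ hx); first by apply: inHD => //; exact: inHZ.
by apply: nearW => k; apply: limit_dir_transv_nat.
Qed.

(** The vectors [ls k *: us k] tending to [v] need not be orthogonal to [z]. Replacing [z] by
    [z - r k *: y] makes them so, and [r k] tends to 0 because [om v z = 0]. *)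
Lemma limit_dir_shear v z y : limit_dir v -> (forall c, limit_dir (z + c *: y)) ->
  om v z = 0 -> om v y != 0 -> limit_dir (z + v).
Proof.
move=> [hv [us [ls [du hus]]]] hz vz vy.
have [hz0 _] := hz 0; rewrite scale0r addr0 in hz0.
pose r k := om (ls k *: us k) z / om (ls k *: us k) y.
have hy : (fun k => om (ls k *: us k) y) @ \oo --> om v y.
  by apply: cvg_sform => //; exact: cvg_rV_cst.
have hr : r @ \oo --> 0 / om v y.
  rewrite -vz; apply: cvgM; last exact: cvgV.
  by apply: cvg_sform => //; exact: cvg_rV_cst.
have hx : cvg_rV (fun k => z + (- r k) *: y + ls k *: us k) (z + (- (0 / om v y)) *: y + v).
  apply: cvg_rVD => //; apply: cvg_rVD; first exact: cvg_rV_cst.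
  by apply: cvg_rVZ; [exact: cvgN | exact: cvg_rV_cst].
rewrite mul0r oppr0 scale0r addr0 in hx.
apply: (limit_dir_closed _ _ hx); first exact: inHD.
have : \forall k \near \oo, om (ls k *: us k) y != 0 by move/cvgr_neq0: hy; apply.
apply: filterS => k uy; apply: (limit_dir_shear_preserving (y := y)) => //.
- by move=> c; rewrite -addrA -scalerDl.
- rewrite /r !sformE; move: uy; rewrite !sformE mulf_eq0 negb_or => /andP[l0 u0].
  by field; apply/andP.
- by move: uy; rewrite !sformE mulf_eq0 negb_or => /andP[].
Qed.

(** If one vector works for [f] only and another for [h] only, their sum works for both. *)
Lemma common_nonzero (P : V -> Prop) (f h : V -> R) :
  (forall x y, P x -> P y -> P (x + y)) ->
  {morph f : x y / x + y} -> {morph h : x y / x + y} ->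
  (exists2 x, P x & f x != 0) -> (exists2 x, P x & h x != 0) ->
  exists2 x, P x & f x != 0 /\ h x != 0.
Proof.
move=> PD fD hD [x Px fx] [y Py hy].
have [hx|hx] := eqVneq (h x) 0; last by exists x.
have [fy|fy] := eqVneq (f y) 0; last by exists y.
by exists (x + y); [exact: PD | rewrite fD hD hx fy addr0 add0r].
Qed.

(** Vectors of [U] orthogonal to [a] are sheared along [a]; generic vectors of [U] are then treated
    by a shear along a vector of [U]; the others are limits of generic ones. *)
Lemma limit_dir_grow (U : {vspace V}) a : (forall z, z \in U -> limit_dir z) -> preserving a ->
  (exists p q, [/\ p \in U, q \in U & om p q != 0]) ->
  (exists2 y, y \in U & om a y != 0) ->
  forall v t, v \in U -> limit_dir (v + t *: a).
Proof.
move=> hU da [p [q [pU qU pq]]] [y yU ay] v t vU.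
have [ha _] := da; have UH z : z \in U -> inH z by move=> /hU[].
have KW w c : w \in U -> om a w = 0 -> limit_dir (w + c *: a).
  move=> wU aw; have [->|c0] := eqVneq c 0; first by rewrite scale0r addr0; apply: hU.
  apply: (limit_dir_shear (y := y)).
  - exact: preserving_limit_dir.
  - by move=> d; apply: hU; apply: memvD => //; exact: memvZ.
  - by rewrite sformZl aw mulr0.
  - by rewrite sformZl mulf_neq0.
(* If all vectors of [U] orthogonal to [a] were in the radical of [U], projecting [p] and [q] onto
   them along [y] would give [om p q = 0]. *)
have [w0 [w0U aw0 [v0 v0U vw0]]] : exists w0, [/\ w0 \in U, om a w0 = 0 &
    exists2 v0, v0 \in U & om v0 w0 != 0].
  apply: contrapT => no.
  have W0 w v' : w \in U -> om a w = 0 -> v' \in U -> om v' w = 0.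
    move=> wU aw v'U; apply/eqP; apply: contraT => vw.
    by case: no; exists w; split=> //; exists v'.
  have proj x : x \in U -> x - (om a x / om a y) *: y \in U /\
      om a (x - (om a x / om a y) *: y) = 0.
    move=> xU; split; first by rewrite memvB // memvZ.
    by rewrite !sformE divfK // subrr.
  have [pU' ap] := proj p pU; have [qU' aq] := proj q qU.
  have e1 := W0 _ _ qU' aq pU; have e2 := W0 _ _ pU' ap yU.
  move: e1 e2; rewrite !sformE (om_self (UH _ yU)).
  rewrite (sform_skew skew_Om (UH _ pU) (UH _ yU)) mulr0 oppr0 addr0.
  move=> /[swap] /eqP; rewrite oppr_eq0 => /eqP ->.
  by rewrite mulr0 subr0 => /eqP; rewrite (negPf pq).
(* The constant [c] makes [v1 - c *: w0] orthogonal to [c *: w0 + t *: a], and these two vectors add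
   up to [v1 + t *: a]. *)
have gen v1 : v1 \in U -> om a v1 != 0 -> om v1 w0 != 0 -> limit_dir (v1 + t *: a).
  move=> v1U av1 v1w0; pose c := - (t * om v1 a / om v1 w0).
  have v1a : om v1 a != 0 by rewrite (sform_skew skew_Om ha (UH _ v1U)) oppr_eq0.
  have wU : c *: w0 \in U by exact: memvZ.
  have aw : om a (c *: w0) = 0 by rewrite sformZr aw0 mulr0.
  have wa : om (c *: w0) a = 0.
    by rewrite (sform_skew skew_Om ha (UH _ wU)) aw oppr0.
  have -> : v1 + t *: a = c *: w0 + t *: a + (v1 - c *: w0).
    by rewrite [RHS]addrC addrA subrK.
  apply: (limit_dir_shear (y := a)).
  - by apply: hU; rewrite memvB.
  - by move=> d; rewrite -addrA -scalerDl; apply: KW.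
  - rewrite sformDl sformNl 2!sformDr [om _ (t *: a)]sformZr [X in _ - (_ + X)]sformZr wa.
    rewrite (om_self (UH _ wU)) mulr0 addr0 subr0 sformZr /c; field.
    exact: v1w0.
  - by rewrite sformDl sformNl wa subr0.
(* A small perturbation of [v] along [r] satisfies both conditions of [gen]. *)
have [r rU [ar rw]] : exists2 r, r \in U & om a r != 0 /\ om r w0 != 0.
  apply: (common_nonzero (P := fun x => x \in U) (f := om a) (h := fun x => om x w0)).
  - by move=> x z; exact: memvD.
  - by move=> x z; exact: sformDr.
  - by move=> x z; exact: sformDl.
  - by exists y.
  - by exists v0.
have hx : cvg_rV (fun k => v + (1 / k.+1%:R) *: r + t *: a) (v + 0 *: r + t *: a).
  apply: cvg_rVD; last exact: cvg_rV_cst.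
  apply: cvg_rVD; first exact: cvg_rV_cst.
  by apply: cvg_rVZ; [exact: cvg_inv_nat | exact: cvg_rV_cst].
rewrite scale0r addr0 in hx; apply: (limit_dir_closed _ _ hx).
  by apply: inHD; [exact: UH | exact: inHZ].
apply: filterS (filterI (near_affine_neq0 (om a v) ar) (near_affine_neq0 (om v w0) rw)).
move=> k [k1 k2]; apply: gen; rewrite ?memvD ?memvZ // !sformE div1r mulrC //.
Qed.

(** * From the rows of [Om] to all vectors of its row space *)

Hypothesis preserving_row : forall i, preserving (row i Om).
Hypothesis Om_unit : exists i j, Om i j = 1 \/ Om i j = -1.
Hypothesis Om_connected : forall S : pred 'I_n, (exists i, S i) ->
  (forall i j, S i -> Om i j != 0 -> S j) -> forall i, S i.

Lemma om_row i v : inH v -> om (row i Om) v = v 0 i.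
Proof.
move=> hv; rewrite rowE sform_dot // mxE (bigD1 i) //= big1 => [|j /negPf ji].
  by rewrite !mxE !eqxx mul1r addr0.
by rewrite !mxE ji andbF mul0r.
Qed.

(** The plane of two rows pairing to 1 or -1 is not isotropic; it is enlarged row by row, by
    induction on a bound for the codimension. *)
Lemma limit_dir_all w : inH w -> limit_dir w.
Proof.
have [i [j Oij]] := Om_unit.
have ij1 : om (row j Om) (row i Om) = 1 \/ om (row j Om) (row i Om) = -1.
  by rewrite om_row ?row_sub // mxE.
suff [U hU rU] : exists2 U : {vspace V}, forall z, z \in U -> limit_dir z &
    forall k, row k Om \in U.
  move=> /submxP[c ->]; apply: hU; rewrite mulmx_sum_row.
  by apply: memv_suml => x _; exact: memvZ.
have grow m : forall U : {vspace V}, (forall z, z \in U -> limit_dir z) ->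
    row j Om \in U -> row i Om \in U -> (\dim {:V} - \dim U <= m)%N ->
    exists2 U : {vspace V}, forall z, z \in U -> limit_dir z & forall k, row k Om \in U.
  elim: m => [|m IH] U hU jU iU dU.
    exists U => // x; have -> : U = {:V}%VS; last exact: memvf.
    by apply/eqP; rewrite eqEdim subvf /= -subn_eq0 -leqn0.
  have [all_in|some_out] := pselect (forall k, row k Om \in U); first by exists U.
  (* Otherwise the indices of the rows in [U] would be closed under adjacency, and connectedness
     would put all rows in [U]. *)
  have [x [y [xU yU xy]]] : exists x y : 'I_n,
      [/\ row x Om \in U, row y Om \notin U & Om x y != 0].
    apply: contrapT => no; apply: some_out.
    refine (@Om_connected (fun k => row k Om \in U) _ _); first by exists i.
    move=> x y xU xy; apply: contraT => yU; case: no; by exists x, y.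
  have yx : om (row y Om) (row x Om) != 0 by rewrite om_row ?row_sub // mxE.
  apply: (IH (U + <[row y Om]>)%VS).
  - move=> z /memv_addP[v vU [_ /vlineP[t ->] ->]].
    apply: (limit_dir_grow hU) => //; last by exists (row x Om).
    exists (row j Om), (row i Om); split=> //.
    by case: ij1 => ->; rewrite ?oppr_eq0 oner_eq0.
  - exact: subvP (addvSl _ _) _ jU.
  - exact: subvP (addvSl _ _) _ iU.
  - have lt : (\dim U < \dim (U + <[row y Om]>))%N.
      rewrite ltnNge; apply/negP => le.
      have /eqP eU : U == (U + <[row y Om]>)%VS by rewrite eqEdim addvSl.
      case/negP: yU; rewrite eU; exact: subvP (addvSr _ _) _ (memv_line _).
    by move: dU (dimvS (subvf (U + <[row y Om]>)%VS)) lt; lia.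
apply: (grow _ <<[:: row j Om; row i Om]>>%VS _ _ _ (leqnn _)).
- move=> z; rewrite span_cons span_seq1 => /memv_addP[_ /vlineP[s ->] [_ /vlineP[t ->] ->]].
  exact: limit_dir_plane.
- by rewrite memv_span // !inE eqxx.
- by rewrite memv_span // !inE eqxx orbT.
Qed.

(** * Changes of adapted frame, and pushing a flag towards a vector *)

Definition triangular (c : R) (r : 'I_g -> R) b : 'I_g -> V :=
  fun j => if j == i0 then c *: b i0 else b j - r j *: b i0.

Lemma om_sumr (I : finType) u (c : I -> R) (F : I -> V) :
  om u (\sum_i c i *: F i) = \sum_i c i * om u (F i).
Proof.
rewrite (big_morph (om u) (fun x y => sformDr Om x y u) (sform0r Om u)).
by apply: eq_bigr => i _; exact: sformZr.
Qed.

(** For freeness, pairing a relation with dual vectors kills first the coefficients away from [i0],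
    then the one at [i0]. *)
Lemma lag_frame_triangular c r b : c != 0 -> lag_frame b -> lag_frame (triangular c r b).
Proof.
move=> c0 lb; have [hb ib fb] := lb; split=> [i|i j|].
- by rewrite /triangular; case: ifP => _; [exact: inHZ | apply: inHB => //; exact: inHZ].
- by rewrite /triangular; case: ifP => _; case: ifP => _; rewrite !sformE !ib; ring.
apply: inj_row_free => v; rewrite mul_frame_mx => v0.
have vk k : k != i0 -> v 0 k = 0.
  move=> ki; have [z [_ zb]] := lag_frame_dual k lb.
  have := congr1 (om z) v0; rewrite om_sumr sform0r (bigD1 k) //= big1 => [|j jk].
    by rewrite /triangular (negPf ki) !sformE !zb eqxx eq_sym (negPf ki) mulr0 subr0 mulr1 addr0.
  rewrite /triangular; case: ifP => _;
  by rewrite !sformE !zb ?(negPf jk) eq_sym (negPf ki) mulr0 ?subr0 mulr0.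
apply/rowP => k; rewrite mxE; have [->|/vk//] := eqVneq k i0.
have [z [_ zb]] := lag_frame_dual i0 lb.
have := congr1 (om z) v0; rewrite om_sumr sform0r (bigD1 i0) //= big1 => [|j jk].
  rewrite /triangular eqxx !sformE !zb eqxx mulr1 addr0 => /eqP.
  by rewrite mulf_eq0 (negPf c0) orbF => /eqP.
by rewrite vk // mul0r.
Qed.

Lemma Flag_triangular c r b : c != 0 -> Flag (triangular c r b) = Flag b.
Proof.
have i0_min j : (i0 <= j)%N by rewrite i0E.
move=> c0; apply: eq_Flag => j.
- rewrite /triangular; case: eqP => [->|_]; first by apply: memvZ; exact: mem_Flag.
  by rewrite memvB ?memvZ // mem_Flag.
- have b0 : b i0 \in Flag (triangular c r b) j.
    have -> : b i0 = c^-1 *: triangular c r b i0.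
      by rewrite /triangular eqxx scalerA mulVf // scale1r.
    by apply: memvZ; exact: mem_Flag.
  have [ji|ji] := eqVneq j i0; first by rewrite {1}ji.
  have -> : b j = triangular c r b j + r j *: b i0 by rewrite /triangular (negPf ji) subrK.
  by rewrite memvD ?memvZ // mem_Flag.
Qed.

Lemma frame_in_triangular c r b : c != 0 -> lag_frame b ->
  frame_in (triangular c r b) <-> frame_in b.
Proof.
move=> c0 lb; rewrite /frame_in Flag_triangular //.
by split=> -[_ Cb]; split=> //; exact: lag_frame_triangular.
Qed.

(** For [w] not orthogonal to [b i0], an adapted frame of the flag [<w> + F_i :&: w^perp]: the
    corrected vectors span the part orthogonal to [w]. *)
Definition push w b : 'I_g -> V :=
  fun j => if j == i0 then w else b j - (om w (b j) / om w (b i0)) *: b i0.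

Lemma lag_frame_push w b : inH w -> om w (b i0) != 0 -> lag_frame b -> lag_frame (push w b).
Proof.
move=> hw w0 lb; have [hb ib fb] := lb.
have wphi j : j != i0 -> om w (push w b j) = 0.
  by move=> ji; rewrite /push (negPf ji) !sformE divfK // subrr.
have hphi j : inH (push w b j).
  by rewrite /push; case: ifP => _ //; apply: inHB => //; exact: inHZ.
split=> // [i j|].
  have [->|ii] := eqVneq i i0; have [->|ji] := eqVneq j i0.
  - exact: om_self.
  - by rewrite {1}/push eqxx wphi.
  - by rewrite (sform_skew skew_Om (hphi _) (hphi _)) {1}/push eqxx wphi // oppr0.
  - by rewrite /push (negPf ii) (negPf ji) !sformE !ib; ring.
apply: inj_row_free => v; rewrite mul_frame_mx => v0.
(* Pairing with [b i0] isolates the coefficient of [w], as the other vectors lie in the isotropic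
   span of [b]. *)
have vi0 : v 0 i0 = 0.
  have := congr1 (om (b i0)) v0; rewrite om_sumr sform0r (bigD1 i0) //= big1 => [|j jk].
    rewrite {1}/push eqxx addr0 (sform_skew skew_Om hw (hb _)) => /eqP.
    by rewrite mulf_eq0 oppr_eq0 (negPf w0) orbF => /eqP.
  by rewrite /push (negPf jk) !sformE !ib; ring.
apply/rowP => k; rewrite mxE; have [->//|ki] := eqVneq k i0.
have [z [_ zb]] := lag_frame_dual k lb.
have := congr1 (om z) v0; rewrite om_sumr sform0r (bigD1 k) //= big1 => [|j jk].
  by rewrite /push (negPf ki) !sformE !zb eqxx eq_sym (negPf ki) mulr0 subr0 mulr1 addr0.
have [->|ji] := eqVneq j i0; first by rewrite vi0 mul0r.
by rewrite /push (negPf ji) !sformE !zb (negPf jk) eq_sym (negPf ki) mulr0 subr0 mulr0.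
Qed.

Lemma closedC_near (bs : nat -> 'I_g -> V) b : (\forall k \near \oo, frame_in (bs k)) ->
  lag_frame b -> (forall i, cvg_rV (fun k => bs k i) (b i)) -> frame_in b.
Proof.
move=> [N _ hN] lb hb; apply: (closedC (bs := fun k => bs (k + N)%N)) => //.
  by move=> k; apply: hN => /=; exact: leq_addl.
by move=> i j; rewrite (cvg_shiftn N (fun k => bs k i 0 j)); exact: hb.
Qed.

(* High powers of a transvection along [u] push the first line of a flag
   towards [u] and fix the part of the flag orthogonal to [u]. *)
Lemma frame_in_push w b : inH w -> om w (b i0) != 0 -> frame_in b -> frame_in (push w b).
Proof.
move=> hw w0 Cb; have [lb _] := Cb; have [hb ib fb] := lb.
have [_ [us [ls [du hus]]]] := limit_dir_all hw.
(* Exponents so large that the factor [c k] below tends to 0. *)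
have big_power k : exists m : nat,
    `|ls k / om (us k) (b i0)| * k.+1%:R < m%:R.
  exists (Num.bound (`|ls k / om (us k) (b i0)| * k.+1%:R)).
  by apply: archi_boundP; exact: mulr_ge0.
have [ms hms] := choice big_power.
(* When nothing degenerates, multiplying the image of [b i0] by [c k] gives
   [ls k *: us k + c k *: b i0], which tends to [w]. *)
pose c k := ls k / om (us k) (b i0) / (ms k)%:R.
pose bs k j := if j == i0 then ls k *: us k + c k *: b i0
  else b j - (om (ls k *: us k) (b j) / om (ls k *: us k) (b i0)) *: b i0.
have cvg_om j : (fun k => om (ls k *: us k) (b j)) @ \oo --> om w (b j).
  by apply: cvg_sform => //; exact: cvg_rV_cst.
have cvg_c : c @ \oo --> 0.
  apply/cvgrPdist_lt => e e0; have /cvgrPdist_lt/(_ e e0) := @cvg_inv_nat R 1.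
  apply: filterS => k; rewrite !sub0r !normrN div1r ger0_norm ?invr_ge0 //.
  apply: le_lt_trans; rewrite /c normrM normfV normr_nat.
  have h := hms k; have d0 : 0 < k.+1%:R :> R by [].
  have m0 : 0 < (ms k)%:R :> R.
    by apply: le_lt_trans h; exact: mulr_ge0.
  by rewrite ler_pdivrMr // [_^-1 * _]mulrC ler_pdivlMr // ltW.
apply: (@closedC_near bs).
- have : \forall k \near \oo, om (ls k *: us k) (b i0) != 0.
    by move/cvgr_neq0: (cvg_om i0); apply.
  apply: filterS => k uk; have := uk; rewrite sformZl mulf_eq0 negb_or => /andP[l0 u0].
  have m0 : (ms k)%:R != 0 :> R.
    by apply: lt0r_neq0; apply: le_lt_trans (hms k); exact: mulr_ge0.
  have c0 : c k != 0 by rewrite !mulf_neq0 // invr_eq0.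
  have Cu := preserving_nat (ms k) (du k) Cb; have [lu _] := Cu.
  (* So [bs k] has the same flag as the image of [b] under a power of a preserving transvection. *)
  suff -> : bs k = triangular (c k) (fun j => om (us k) (b j) / om (us k) (b i0))
      (tv (us k) (ms k)%:R \o b) by apply/frame_in_triangular.
  apply: funext => j; rewrite /bs /triangular /=; case: eqP => _.
    rewrite /transv scalerDr scalerA addrC; congr (_ + _ *: _).
    by rewrite /c; field; apply/andP.
  rewrite !sformZl -transvZ -transvB.
  rewrite -mulf_div divff // mul1r.
  by rewrite /transv !sformE divfK // subrr mulr0 scale0r addr0.
- exact: lag_frame_push.
move=> j; rewrite /bs /push; case: eqP => [_|_].
  have -> : w = w + 0 *: b i0 by rewrite scale0r addr0.
  by apply: cvg_rVD => //; apply: cvg_rVZ => //; exact: cvg_rV_cst.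
apply: cvg_rVD; first exact: cvg_rV_cst.
under eq_fun do rewrite -scaleNr.
rewrite -scaleNr; apply: cvg_rVZ; last exact: cvg_rV_cst.
by apply: cvgN; apply: cvgM => //; exact: cvgV.
Qed.

(* [push w] only sees the part of the flag orthogonal to [w], which the
   transvection fixes, and [push (tv w s (b i0))] undoes [push w]. *)
Lemma frame_in_transv_generic w s b : inH w -> om w (b i0) != 0 ->
  frame_in b -> frame_in (tv w s \o b).
Proof.
move=> hw w0 Cb; have [lb _] := Cb; have [hb ib fb] := lb.
have Tb0 : om (tv w s (b i0)) w = om (b i0) w.
  by rewrite /transv !sformE om_self // !mulr0 addr0.
have b0w : om (b i0) w != 0 by rewrite (sform_skew skew_Om hw (hb _)) oppr_eq0.
have := @frame_in_push (tv w s (b i0)) (push w b) (inH_transv _ hw (hb _)).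
have -> : push w b i0 = w by rewrite /push eqxx.
rewrite Tb0 => /(_ b0w (frame_in_push hw w0 Cb)).
rewrite (_ : push _ _ = triangular 1 (fun j => om w (b j) / om w (b i0)) (tv w s \o b)).
  by rewrite frame_in_triangular ?oner_eq0 //; exact: lag_frame_transv.
apply: funext => j; rewrite /triangular {1}/push.
case: eqP => [_|/eqP ji] /=; first by rewrite scale1r.
have -> : push w b i0 = w by rewrite /push eqxx.
rewrite {1 2}/push (negPf ji).
rewrite -transvZ -transvB.
set x := b j - _.
have wx : om w x = 0 by rewrite /x !sformE divfK // subrr.
have b0x : om (b i0) x = 0 by rewrite /x !sformE !ib; ring.
clearbody x; rewrite [X in X / _](_ : _ = 0); last by rewrite /transv !sformE wx b0x; ring.
by rewrite mul0r scale0r subr0 /transv wx mulr0 scale0r addr0.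
Qed.

(** The generic case applies to [w] perturbed along a vector dual to [b i0]; closedness gives the
    limit. *)
Lemma frame_in_transv w s b : inH w -> frame_in b -> frame_in (tv w s \o b).
Proof.
move=> hw Cb; have [lb _] := Cb; have [hb ib fb] := lb.
have [y [hy yb]] := lag_frame_dual i0 lb.
have y0 : om y (b i0) != 0 by rewrite yb eqxx oner_eq0.
apply: (@closedC_near (fun k => tv (w + (1 / k.+1%:R) *: y) s \o b)).
- apply: filterS (near_affine_neq0 (om w (b i0)) y0) => k hk.
  apply: frame_in_transv_generic => //; first by apply: inHD => //; exact: inHZ.
  by rewrite !sformE div1r mulrC.
- exact: lag_frame_transv.
move=> i; apply: cvg_transv; [|exact: cvg_rV_cst|exact: cvg_cst].
have {2}-> : w = w + 0 *: y by rewrite scale0r addr0.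
apply: cvg_rVD; first exact: cvg_rV_cst.
by apply: cvg_rVZ; [exact: cvg_inv_nat|exact: cvg_rV_cst].
Qed.

(** The transvection along [x - b j], with coefficient the inverse of [om x (b j)], takes [b j] to
    [x]. It fixes the earlier vectors, which are orthogonal to both. *)
Lemma move_vector (f : 'I_g -> V) b (j : 'I_g) x : lag_frame f -> frame_in b ->
  (forall i : 'I_g, (i < j)%N -> b i = f i) ->
  inH x -> (forall i : 'I_g, (i < j)%N -> om x (f i) = 0) -> om x (b j) != 0 ->
  exists2 b', frame_in b' & b' j = x /\ forall i : 'I_g, (i < j)%N -> b' i = f i.
Proof.
move=> [hf jf _] Cb bf hx xf xb; have [[hb ib _] _] := Cb.
have hy : inH (x - b j) by exact: inHB.
have yb : om (x - b j) (b j) = om x (b j) by rewrite !sformE om_self // subr0.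
exists (tv (x - b j) (om x (b j))^-1 \o b); first exact: frame_in_transv.
split=> [|i ij] /=; rewrite /transv.
  by rewrite yb mulVf // scale1r addrC subrK.
by rewrite bf // !sformE xf // -(bf _ ij) ib subrr mulr0 scale0r addr0.
Qed.

(** The vectors are corrected one after another. As [b j] and [f j] may be orthogonal, [b j] goes to
    [f j] through a vector [z] that is orthogonal to neither. *)
Lemma frame_in_all b f : frame_in b -> lag_frame f -> frame_in f.
Proof.
move=> Cb lf; have [hf jf _] := lf.
suff agree m : (m <= g)%N ->
    exists2 b', frame_in b' & forall i : 'I_g, (i < m)%N -> b' i = f i.
  have [b' Cb' b'f] := agree g (leqnn g).
  by have <- : b' = f by apply: funext => i; exact: b'f.
elim: m => [|m IH] mg; first by exists b.
have {b Cb IH}[b Cb bf] := IH (ltnW mg); have [lb _] := Cb.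
pose j := Ordinal mg.
have orth x y : (forall i : 'I_g, (i < j)%N -> om x (f i) = 0) ->
    (forall i : 'I_g, (i < j)%N -> om y (f i) = 0) ->
    forall i : 'I_g, (i < j)%N -> om (x + y) (f i) = 0.
  by move=> hx hy i ij; rewrite sformDl hx // hy // addr0.
have [z [hz zf] [zb zfj]] : exists2 z,
    inH z /\ (forall i : 'I_g, (i < j)%N -> om z (f i) = 0) &
    om z (b j) != 0 /\ om z (f j) != 0.
  apply: (common_nonzero (f := fun z => om z (b j)) (h := fun z => om z (f j))).
  - by move=> x y [hx xf] [hy yf]; split; [exact: inHD | exact: orth].
  - by move=> x y; exact: sformDl.
  - by move=> x y; exact: sformDl.
  - have [x [hx xb]] := lag_frame_dual j lb; exists x; last by rewrite xb eqxx oner_eq0.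
    split=> // i ij; rewrite -bf // xb; case: eqP => // e.
    by move: ij; rewrite e ltnn.
  - have [x [hx xb]] := lag_frame_dual j lf; exists x; last by rewrite xb eqxx oner_eq0.
    split=> // i ij; rewrite xb; case: eqP => // e.
    by move: ij; rewrite e ltnn.
have [b1 Cb1 [b1j b1f]] := move_vector (j := j) lf Cb bf hz zf zb.
have fz : om (f j) (b1 j) != 0.
  by rewrite b1j (sform_skew skew_Om hz (hf _)) oppr_eq0.
have [b2 Cb2 [b2j b2f]] := move_vector (j := j) lf Cb1 b1f (hf j) (fun i _ => jf _ _) fz.
exists b2 => // i; rewrite ltnS leq_eqVlt => /orP[/eqP e|]; last exact: b2f.
by have -> : i = j by exact: val_inj.
Qed.
End Minimality.

(** * Rauzy diagrams *)

Section RauzyRows.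
Local Open Scope nat_scope.
Variable A : finType.
Local Notation d := #|A|.
Implicit Types (q p : rperm A) (r : {ffun A -> nat}) (b c : bool).

Definition valid_row r := injective r /\ forall x, 1 <= r x <= d.

Lemma valid_row_surj r k : valid_row r -> 1 <= k <= d -> exists x, r x = k.
Proof.
move=> [rI rb] kd; have d0 : 0 < d by lia.
have ltx x : (r x).-1 < d by have := rb x; lia.
have kP : k.-1 < d by lia.
have fI : injective (fun x => Ordinal (ltx x)).
  by move=> x y /(congr1 val) /= e; apply: rI; have := rb x; have := rb y; lia.
have [h _ hK] : bijective (fun x => Ordinal (ltx x)).
  by apply: inj_card_bij => //; rewrite card_ord.
have /(congr1 val) := hK (Ordinal kP); move: (h _) => x /= e.
by exists x; have := rb x; lia.
Qed.

Lemma card_row_le r k : valid_row r -> k <= d -> #|[set x | r x <= k]| = k.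
Proof.
move=> hr kd; have [rI rb] := hr; apply/eqP; rewrite eqn_leq; apply/andP; split.
  have ltx (x : A) : (minn (r x) k).-1 < k.+1 by lia.
  case: k => [|k] in kd ltx *.
    by rewrite leqn0 cards_eq0; apply/eqP/setP => x; rewrite !inE; have := rb x; lia.
  rewrite -[X in _ <= X]card_ord.
  have ltk (x : A) : (minn (r x) k.+1).-1 < k.+1 by lia.
  rewrite -(card_in_imset (f := fun x => Ordinal (ltk x))) ?max_card // => x y.
  rewrite !inE => hx hy /(congr1 val) /= e; apply: rI; have := rb x; have := rb y; lia.
have /choice[f hf] (i : 'I_k) : exists x, r x = i.+1.
  by apply: valid_row_surj => //; have := ltn_ord i; lia.
rewrite -[X in X <= _]card_ord -(card_imset (f := f)); last first.
  by move=> i j e; apply: val_inj; have := hf i; rewrite e hf => -[].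
by apply/subset_leq_card/fintype.subsetP => _ /imsetP[i _ ->]; rewrite inE hf.
Qed.

Lemma initial_segment r (B : {set A}) : valid_row r ->
  (forall x y, x \in B -> r y <= r x -> y \in B) ->
  forall x, (x \in B) = (r x <= #|B|).
Proof.
move=> hr dB x; have [rI rb] := hr; have rx := rb x; apply/idP/idP => [xB|le].
  rewrite -[X in X <= _](card_row_le hr (k := r x)); last by lia.
  by apply/subset_leq_card/fintype.subsetP => y; rewrite inE; exact: dB xB.
apply: contraT => xB.
have : #|B| <= #|[set y | r y <= (r x).-1]|.
  apply/subset_leq_card/fintype.subsetP => y yB; rewrite inE; have := rb x.
  have [h|h] := leqP (r x) (r y); last by lia.
  by case/negP: xB; exact: dB yB h.
rewrite card_row_le //; lia.
Qed.

(* The operation [b] keeps [row_of b p] and inserts a letter in [row_of (~~ b) p]. *)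
Definition row_of b p := if b then p.1 else p.2.
Definition good_perm p := [/\ 2 <= d, valid_perm p & irreducible p].

Lemma good_row p b : good_perm p -> valid_row (row_of b p).
Proof. by move=> [_ [i1 i2 h] _]; case: b; split=> // x; have /andP[] := h x. Qed.

Lemma good_irr p b k : good_perm p -> 1 <= k < d ->
  ~ (forall x, (row_of b p x <= k) = (row_of (~~ b) p x <= k)).
Proof.
by move=> [_ _ irr] hk h; apply: irr; exists k; split=> // x; have := h x; case: (b).
Qed.

(** Irreducibility for sets of letters: a nonempty proper set that is initial in both rows has the
    same length in both. *)
Lemma good_no_initial p (B : {set A}) x y : good_perm p -> x \in B -> y \notin B ->
  (forall b x y, x \in B -> row_of b p y <= row_of b p x -> y \in B) -> False.
Proof.
move=> gp xB yB dB; apply: (@good_irr p true #|B| gp).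
  apply/andP; split; first by apply/card_gt0P; exists x.
  rewrite -cardsT; apply/proper_card/fintype.properP; split; first exact: finset.subsetT.
  by exists y.
move=> z; rewrite -!initial_segment //; try exact: good_row.
  exact: dB.
exact: dB.
Qed.

Lemma row_le p b x : good_perm p -> row_of b p x <= d.
Proof. by move=> /(good_row b)[_ /(_ x)] /andP[]. Qed.

Lemma row_inj p b x y : good_perm p -> row_of b p x = row_of b p y -> x = y.
Proof. by move=> /(good_row b)[rI _]; exact: rI. Qed.

Lemma row_last p b x : good_perm p -> row_of b p x = d ->
  (if b then last_top p else last_bot p) = Some x.
Proof.
move=> gp xd; case: b xd => xd; rewrite /last_top /last_bot; case: pickP => [y /eqP yd|/(_ x)].
- by congr Some; apply: (row_inj (b := true) gp); rewrite yd.
- by rewrite xd eqxx.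
- by congr Some; apply: (row_inj (b := false) gp); rewrite yd.
- by rewrite xd eqxx.
Qed.

(** If the two last letters coincided, the first [d - 1] positions would carry the same letters in
    both rows. *)
Lemma winner_loserP b p w l : good_perm p -> row_of b p w = d -> row_of (~~ b) p l = d ->
  winner_loser b p = Some (w, l) /\ w != l.
Proof.
move=> gp wd ld; split.
  rewrite /winner_loser; have := row_last gp wd; have := row_last gp ld.
  by case: (b) => /= -> ->.
apply/eqP => e; move: ld; rewrite -{}e => ld; have [d2 _ _] := gp.
apply: (@good_irr p b d.-1 gp) => [|x]; first by lia.
have [->|xw] := eqVneq x w; first by rewrite wd ld.
have h c : row_of c p w = d -> row_of c p x <= d.-1.
  move=> cd; have := row_le c x gp; rewrite leq_eqVlt => /orP[/eqP e|]; last by lia.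
  by case/eqP: xw; apply: (row_inj (b := c) gp); rewrite e.
by rewrite !h.
Qed.

Lemma row_last_ex p b : good_perm p -> exists x, row_of b p x = d.
Proof. by move=> gp; have [d2 _ _] := gp; apply: valid_row_surj; [exact: good_row | lia]. Qed.

Lemma row_rauzy b p w l : good_perm p -> row_of b p w = d -> row_of (~~ b) p l = d ->
  row_of b (rauzy b p) = row_of b p /\
  row_of (~~ b) (rauzy b p) = insert_after (row_of (~~ b) p) w l.
Proof.
by move=> gp wd ld; rewrite /rauzy; have [-> _] := winner_loserP gp wd ld; case: (b).
Qed.

(** If the first [k] positions of the new rows agreed, the winner, last in the kept row, would lie
    beyond [k] in both. The insertion would take place beyond [k] too, so the old rows would agree
    up to [k]. *)
Lemma good_rauzy b p : good_perm p -> good_perm (rauzy b p).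
Proof.
move=> gp; have [w wd] := row_last_ex b gp; have [l ld] := row_last_ex (~~ b) gp.
have [e1 e2] := row_rauzy gp wd ld; have [_ wl] := winner_loserP gp wd ld.
have [d2 _ _] := gp.
have wld : row_of (~~ b) p w < d.
  rewrite ltn_neqAle row_le // andbT; apply: contraNneq wl => e.
  by apply/eqP; apply: (row_inj (b := ~~ b) gp); rewrite e.
have v1 : valid_row (row_of b (rauzy b p)) by rewrite e1; exact: good_row.
have v2 : valid_row (row_of (~~ b) (rauzy b p)).
  have [rI rb] := good_row (~~ b) gp; rewrite e2; split=> [x y|x]; rewrite !ffunE.
    have h z : z != l -> row_of (~~ b) p z < d.
      move=> zl; rewrite ltn_neqAle row_le // andbT; apply: contraNneq zl => e.
      by apply/eqP/rI; rewrite e.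
    have := rI x y; have := h x; have := h y.
    case: eqP => [->|_]; case: eqP => [->|_] //= hy hx hxy.
    - by case: ifP => ? ?; lia.
    - by case: ifP => ? ?; lia.
    - by case: ifP => ?; case: ifP => ? ?; apply: hxy; lia.
  have := rb x; case: eqP => [_ _|/eqP xl]; first by lia.
  have : row_of (~~ b) p x < d.
    rewrite ltn_neqAle row_le // andbT; apply: contraNneq xl => e.
    by apply/eqP/rI; rewrite e.
  by case: ifP; lia.
split=> //.
  have v c : valid_row (row_of c (rauzy b p)).
    by have [->|->] : c = b \/ c = ~~ b by case: (b); case: c; [left|right|right|left].
  split; [exact: (v true).1 | exact: (v false).1 | move=> x].
  by rewrite (v true).2 (v false).2.
move=> [k [hk irr]].
have {}irr x : (row_of b (rauzy b p) x <= k) = (row_of (~~ b) (rauzy b p) x <= k).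
  by have := irr x; case: (b).
have wk : k < insert_after (row_of (~~ b) p) w l w.
  by rewrite ltnNge -e2 -irr e1 wd; lia.
apply: (@good_irr p b k gp hk) => x; have := irr x; rewrite e1 e2.
move: wk; rewrite !ffunE (negPf wl) ltnn => wk.
have [->|xl] := eqVneq x l; first by rewrite ld; lia.
by case: ifP => // h; lia.
Qed.

Lemma good_endpoint p s : good_perm p -> good_perm (endpoint p s).
Proof. by elim: s p => //= b s IH p gp; apply: IH; exact: good_rauzy. Qed.

Lemma endpoint_cat p s t : endpoint p (s ++ t) = endpoint (endpoint p s) t.
Proof. exact: foldl_cat. Qed.

(* The moving row [m] after [j] identical operations, [a] being the position of
   the winner. *)
Definition rotate (m : A -> nat) (a j : nat) : {ffun A -> nat} :=
  [ffun z => if m z <= a then m z else if m z + j <= d then m z + j else m z + j - (d - a)].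

(** The winner stays the same, and each operation shifts cyclically the letters on its right in the
    moving row. The bound on [j] allows at most one turn. *)
Lemma endpoint_rotate p b w j : good_perm p -> row_of b p w = d ->
  j <= d - row_of (~~ b) p w ->
  row_of b (endpoint p (nseq j b)) = row_of b p /\
  row_of (~~ b) (endpoint p (nseq j b)) = rotate (row_of (~~ b) p) (row_of (~~ b) p w) j.
Proof.
move=> gp wd; elim: j => [|j IH] hj.
  split=> //=; apply/ffunP => z; rewrite ffunE addn0.
  by rewrite row_le //; case: ifP.
have [e1 e2] := IH (ltnW hj).
have gj := good_endpoint (nseq j b) gp.
have [l ld] := row_last_ex (~~ b) gj.
rewrite -addn1 nseqD endpoint_cat /= -/(endpoint _ _).
have wd' : row_of b (endpoint p (nseq j b)) w = d by rewrite e1.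
have [-> ->] := row_rauzy gj wd' ld; split=> //.
have zd z := row_le (~~ b) z gp; have zI z := @row_inj p (~~ b) z l gp.
have {}ld : rotate (row_of (~~ b) p) (row_of (~~ b) p w) j l = d :> nat by rewrite -e2.
rewrite e2; apply/ffunP => z.
suff : insert_after (rotate (row_of (~~ b) p) (row_of (~~ b) p w) j) w l z =
  rotate (row_of (~~ b) p) (row_of (~~ b) p w) (j + 1) z :> nat by [].
move: ld; rewrite !ffunE leqnn => ld.
have [D DE] : exists D, D = d by exists d.
have := zd z; have := zd l; have := zI z; move: ld hj {zd zI e2}.
rewrite -!DE => {DE}.
move: (row_of (~~ b) p) => m; have [->|zl] := eqVneq z l.
  move=> /= ld hj _ _ ld'; move: ld; do !case: ifP => ?; lia.
move=> ld hj zI ld' zd; have {}zI : m z <> m l :> nat by move=> /zI /eqP; rewrite (negPf zl).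
move: ld; case: (leqP (m l) (m w)) => ?; case: (leqP (m z) (m w)) => ?;
  case: (leqP (m l + j) D) => ?; case: (leqP (m z + j) D) => ? /=;
  do !case: ifP => ?; lia.
Qed.

Lemma endpoint_full_rotate p b w : good_perm p -> row_of b p w = d ->
  endpoint p (nseq (d - row_of (~~ b) p w) b) = p.
Proof.
move=> gp wd; have [e1 e2] := endpoint_rotate gp wd (leqnn _).
have {}e2 : row_of (~~ b) (endpoint p (nseq (d - row_of (~~ b) p w) b)) = row_of (~~ b) p.
  rewrite e2; apply/ffunP => z; rewrite ffunE.
  by do !case: ifP => ?; have := row_le (~~ b) w gp; lia.
move: e1 e2; move: (endpoint _ _) => q; case: (b) => /=.
  by rewrite [q]surjective_pairing [p]surjective_pairing /= => -> ->.
by rewrite [q]surjective_pairing [p]surjective_pairing /= => -> ->.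
Qed.

(** A single operation begins a full turn; the remaining operations of the turn lead back. *)
Lemma return_path p b : good_perm p -> exists s, endpoint (rauzy b p) s = p.
Proof.
move=> gp; have [w wd] := row_last_ex b gp; have [l ld] := row_last_ex (~~ b) gp.
have [_ wl] := winner_loserP gp wd ld.
have wld : row_of (~~ b) p w < d.
  rewrite ltn_neqAle row_le // andbT; apply: contraNneq wl => e.
  by apply/eqP; apply: (row_inj (b := ~~ b) gp); rewrite e.
exists (nseq (d - row_of (~~ b) p w).-1 b).
rewrite -[LHS]/(endpoint p (b :: nseq _ b)) -[b :: _]/(nseq _.+1 b) prednK ?subn_gt0 //.
exact: endpoint_full_rotate.
Qed.

Lemma path_return p s : good_perm p -> exists t, endpoint (endpoint p s) t = p.
Proof.
elim/last_ind: s => [|s b IH] gp; first by exists [::].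
have [t et] := IH gp; have [u eu] := return_path b (good_endpoint s gp).
by exists (u ++ t); rewrite -cats1 !endpoint_cat /= -[endpoint (rauzy b _) u]/(endpoint _ u) eu.
Qed.

(** * Every letter becomes last along some path *)

Definition never_last p x := forall s b, row_of b (endpoint p s) x <> d.

Lemma never_last_endpoint p s x : never_last p x -> never_last (endpoint p s) x.
Proof. by move=> h t b; rewrite -endpoint_cat. Qed.

(** Only the loser can move left, and the loser is last in its row. *)
Lemma row_rauzy_mono p b c x : good_perm p -> never_last p x ->
  row_of c p x <= row_of c (rauzy b p) x.
Proof.
move=> gp nx; have [w wd] := row_last_ex b gp; have [l ld] := row_last_ex (~~ b) gp.
have [e1 e2] := row_rauzy gp wd ld.
have [->|->] : c = b \/ c = ~~ b by case: (b); case: c; [left|right|right|left].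
  by rewrite e1.
rewrite e2 ffunE; have [e|_] := eqVneq x l; last by case: ifP.
by case: (nx [::] (~~ b)); rewrite e.
Qed.

Lemma row_endpoint_mono p s c x : good_perm p -> never_last p x ->
  row_of c p x <= row_of c (endpoint p s) x.
Proof.
elim: s p => //= b s IH p gp nx.
apply: leq_trans (row_rauzy_mono b c gp nx) (IH _ (good_rauzy b gp) _).
exact: (never_last_endpoint (s := [:: b]) nx).
Qed.

(* The position of [x] never decreases along a path; as every path can be
   closed up it never increases either, so no letter is inserted before [x]. *)
Lemma never_last_before_winner p b x w : good_perm p -> never_last p x ->
  row_of b p w = d -> row_of (~~ b) p x < row_of (~~ b) p w.
Proof.
move=> gp nx wd; have [l ld] := row_last_ex (~~ b) gp.
have [e1 e2] := row_rauzy gp wd ld; have [s es] := return_path b gp.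
have := row_endpoint_mono s (~~ b) (good_rauzy b gp) (never_last_endpoint (s := [:: b]) nx).
rewrite es e2 ffunE; have [e|_] := eqVneq x l.
  by case: (nx [::] (~~ b)); rewrite e.
case: ifP => [_|lt _]; first by rewrite ltnn.
rewrite ltn_neqAle [X in _ && X]leqNgt lt andbT; apply/eqP => /(row_inj gp) e.
by case: (nx [::] b); rewrite /= e.
Qed.

(** Insertions happen to the right of [x], so [y] stays at or before [x] in row [c]. There it cannot
    be last; were it last in the other row, it would be a winner, and [x] would precede it in row
    [c]. *)
Lemma never_last_initial p c x y : good_perm p -> never_last p x ->
  row_of c p y <= row_of c p x -> never_last p y.
Proof.
move=> gp nx yx s.
have {yx} : row_of c (endpoint p s) y <= row_of c (endpoint p s) x.
  elim/last_ind: s => // s b IH; rewrite -cats1 endpoint_cat /=.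
  have gq := good_endpoint s gp; have nq := never_last_endpoint (s := s) nx.
  move: IH gq nq; rewrite -/(endpoint _ _); move: (endpoint p s) => q IH gq nq.
  have [w wd] := row_last_ex b gq; have [l ld] := row_last_ex (~~ b) gq.
  have [e1 e2] := row_rauzy gq wd ld.
  have [e|e] : c = b \/ c = ~~ b by case: (b); case: (c); [left|right|right|left].
    by rewrite e e1 -e.
  rewrite e in IH *; rewrite e2 !ffunE.
  have xw := never_last_before_winner gq nq wd.
  have xl : x != l by apply/eqP => xl; case: (nq [::] (~~ b)); rewrite xl.
  have yl : y != l.
    apply/eqP => yl; case: (nq [::] (~~ b)); rewrite /=; apply/eqP.
    by rewrite eqn_leq row_le //= -ld -yl.
  by rewrite (negPf xl) (negPf yl); do !case: ifP => ?; lia.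
have gq := good_endpoint s gp; have nq := never_last_endpoint (s := s) nx.
move: (endpoint p s) gq nq => q gq nq yx b yd.
have [e|e] : b = c \/ b = ~~ c by case: (b); case: (c); [left|right|right|left].
  case: (nq [::] c); rewrite /=; apply/eqP; rewrite eqn_leq row_le //=.
  by rewrite -{1}yd e.
have := never_last_before_winner gq nq yd; rewrite e negbK; lia.
Qed.

(** The letters that are never last form an initial segment of both rows, which misses the last top
    letter. *)
Lemma exists_last p x : good_perm p -> exists s b, row_of b (endpoint p s) x = d.
Proof.
move=> gp; apply: contrapT => no.
have nx : never_last p x by move=> s b e; apply: no; exists s, b.
have [y yd] := row_last_ex true gp.
apply: (@good_no_initial p [set z | `[< never_last p z >]] x y gp).
- by rewrite finset.inE; apply/asboolP.
- by rewrite finset.inE; apply/asboolP => /(_ [::] true).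
move=> b u v; rewrite !finset.inE => /asboolP nu vu; apply/asboolP.
exact: (never_last_initial gp nu vu).
Qed.

(** Otherwise let [T] be whichever of [S] and its complement contains the first top letter. The
    letters of [T] preceding all letters outside [T] form an initial segment of both rows. *)
Lemma good_cross p (S : pred A) x y : good_perm p -> S x -> ~~ S y -> exists s t,
  [/\ S s, ~~ S t & (p.1 s < p.1 t) != (p.2 s < p.2 t)].
Proof.
move=> gp Sx Sy; apply: contrapT => no.
have same s t : S s -> ~~ S t -> (p.1 s < p.1 t) = (p.2 s < p.2 t).
  move=> Ss St; have [//|h] := eqVneq (p.1 s < p.1 t) (p.2 s < p.2 t).
  by case: no; exists s, t.
have [d2 _ _] := gp.
have [f f1] : exists f, p.1 f = 1.
  by apply: valid_row_surj; [exact: (good_row true gp) | lia].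
have pos z : 0 < p.1 z by have [_ /(_ z)] := good_row true gp; case/andP.
have neq z u : z != u -> p.1 z <> p.1 u /\ p.2 z <> p.2 u.
  move=> zu; split=> e; case/eqP: zu; [exact: (row_inj (b := true) gp)|].
  exact: (row_inj (b := false) gp).
have main (T : pred A) z : T f -> ~~ T z ->
    (forall s t, T s -> ~~ T t -> (p.1 s < p.1 t) = (p.2 s < p.2 t)) -> False.
  move=> Tf Tz h.
  have diff s t : T s -> ~~ T t -> s != t by move=> Ts; apply: contraNneq => <-.
  apply: (@good_no_initial p [set s | T s && [forall t, ~~ T t ==> (p.1 s < p.1 t)]] f z gp).
  - rewrite finset.inE Tf; apply/forallP => t; apply/implyP => Tt.
    by have [] := neq _ _ (diff _ _ Tf Tt); have := pos t; rewrite f1; lia.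
  - by rewrite finset.inE (negPf Tz).
  move=> b s u; rewrite !finset.inE => /andP[Ts /forallP hs] us.
  have Tu : T u.
    apply: contraT => Tu; have := hs u; rewrite Tu /= => su.
    have := h _ _ Ts Tu; rewrite su; case: b us => /=; lia.
  rewrite Tu; apply/forallP => t; apply/implyP => Tt.
  have := hs t; rewrite Tt /= => st; case: b us => /= us; first by apply: leq_ltn_trans st.
  by rewrite h //; apply: leq_ltn_trans us _; rewrite -h.
have [Sf|Sf] := boolP (S f); first exact: (main S y).
apply: (main (predC S) x) => //=; first by rewrite negbK.
move=> s t Ss; rewrite negbK => St.
have ts : t != s by apply: contraTneq St => ->.
by have [n1 n2] := neq _ _ ts; have := same _ _ St Ss; lia.
Qed.
End RauzyRows.

(** * The matrices of paths and the transvections among them *)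

Section RauzyMatrices.
Local Open Scope ring_scope.
Variables (R : realType) (A : finType).
Local Notation d := #|A|.
Implicit Types (p q : rperm A) (b : bool) (x y w l z : A).
Local Notation rk := (@enum_rank A).

(** With [s] the row kept by an operation and [m] the moving row, both operations are treated at
    once; exchanging the rows costs the sign [side]. *)
Definition crossing (s m : A -> nat) x y : R :=
  if (s y < s x)%N && (m x < m y)%N then 1
  else if (s x < s y)%N && (m y < m x)%N then -1 else 0.

Definition side b : R := if b then 1 else -1.

Lemma Omega_crossing b p i j : Omega_mx R p i j =
  side b * crossing (row_of b p) (row_of (~~ b) p) (enum_val i) (enum_val j).
Proof.
rewrite mxE /crossing /side; case: b => /=; first by rewrite mul1r.
by do !case: ifP => /=; rewrite ?mulrN1 ?mulN1r ?opprK ?oppr0 //; lia.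
Qed.

Lemma crossing_skew s m x y : crossing s m y x = - crossing s m x y.
Proof. by rewrite /crossing; do !case: ifP => ?; rewrite ?opprK ?oppr0 //; lia. Qed.

Lemma crossing_self s m x : crossing s m x x = 0.
Proof. by rewrite /crossing !ltnn. Qed.

Lemma Omega_skew p : (Omega_mx R p)^T = - Omega_mx R p.
Proof.
by apply/matrixP => i j; rewrite mxE [RHS]mxE !(Omega_crossing true) !mul1r crossing_skew.
Qed.

Lemma Omega_self p i : Omega_mx R p i i = 0.
Proof. by rewrite (Omega_crossing true) crossing_self mulr0. Qed.

(** As [w] is last in [s] and [l] last in [m], a crossing of [w] depends on [m] only and one of [l]
    on [s] only. Their sum is the crossing of a letter placed as [l] in [s] and just after [w] in
    [m]. *)
Lemma crossing_insert (s m : {ffun A -> nat}) w l x y :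
  injective s -> injective m -> (forall z, s z <= s w)%N -> (forall z, m z <= m l)%N ->
  w != l ->
  crossing s (insert_after m w l) x y =
  crossing s m x y + (x == l)%:R * crossing s m w y + (y == l)%:R * crossing s m x w.
Proof.
move=> sI mI sw ml wl.
have neq (r : {ffun A -> nat}) u v : injective r -> u != v -> r u <> r v :> nat.
  by move=> rI uv /rI e; rewrite e eqxx in uv.
have [->|xl] := eqVneq x l; have [->|yl] := eqVneq y l.
- by rewrite !crossing_self (crossing_skew s m l w) /crossing; lra.
- have [->|yw] := eqVneq y w.
    rewrite crossing_self /crossing !ffunE eqxx (negPf wl) ltnn mulr0 mul0r.
    have := neq _ _ _ sI wl; have := sw l; have := neq _ _ _ mI wl; have := ml w.
    by do !case: ifP => ?; move=> *; first [exfalso; lia | lra].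
  rewrite /crossing !ffunE eqxx (negPf yl) mul1r mul0r.
  have := neq _ _ _ sI wl; have := sw l; have := neq _ _ _ mI wl; have := ml w.
  have := neq _ _ _ sI yl; have := sw y; have := neq _ _ _ mI yl; have := ml y.
  have := neq _ _ _ sI yw; have := neq _ _ _ mI yw.
  by case: (ltnP (m w) (m y)) => ?; do !case: ifP => ?; move=> *; first [exfalso; lia | lra].
- have [->|xw] := eqVneq x w.
    rewrite crossing_self /crossing !ffunE eqxx (negPf wl) ltnn mulr0 mul0r.
    have := neq _ _ _ sI wl; have := sw l; have := neq _ _ _ mI wl; have := ml w.
    by do !case: ifP => ?; move=> *; first [exfalso; lia | lra].
  rewrite /crossing !ffunE eqxx (negPf xl) mul1r mul0r.
  have := neq _ _ _ sI wl; have := sw l; have := neq _ _ _ mI wl; have := ml w.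
  have := neq _ _ _ sI xl; have := sw x; have := neq _ _ _ mI xl; have := ml x.
  have := neq _ _ _ sI xw; have := neq _ _ _ mI xw.
  by case: (ltnP (m w) (m x)) => ?; do !case: ifP => ?; move=> *; first [exfalso; lia | lra].
- rewrite !mul0r !addr0 /crossing !ffunE (negPf xl) (negPf yl).
  case: (ltnP (m w) (m x)) => ?; case: (ltnP (m w) (m y)) => ?;
  by do !case: ifP => ?; first [exfalso; lia | lra].
Qed.

Lemma mul_deltaE n (i j : 'I_n) (M : 'M[R]_n) k k' :
  (delta_mx i j *m M) k k' = (k == i)%:R * M j k'.
Proof.
rewrite mxE (bigD1 j) //= big1 => [|u /negPf uj]; rewrite !mxE ?eqxx ?andbT ?addr0 //.
by rewrite uj andbF mul0r.
Qed.

Lemma mul_mx_deltaE n (i j : 'I_n) (M : 'M[R]_n) k k' :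
  (M *m delta_mx i j) k k' = M k i * (k' == j)%:R.
Proof.
rewrite mxE (bigD1 i) //= big1 => [|u /negPf ui]; rewrite !mxE ?eqxx ?addr0 //.
by rewrite ui mulr0.
Qed.

Lemma arrow_mxE b p w l : good_perm p -> row_of b p w = d -> row_of (~~ b) p l = d ->
  arrow_mx R p b = 1%:M + delta_mx (rk w) (rk l).
Proof. by move=> gp wd ld; rewrite /arrow_mx; have [-> _] := winner_loserP gp wd ld. Qed.

Lemma eq_enum_val (i : 'I_d) x : (enum_val i == x) = (i == rk x).
Proof. by rewrite -(inj_eq (@enum_rank_inj A)) enum_valK. Qed.

Lemma Omega_rauzy b p : good_perm p ->
  Omega_mx R (rauzy b p) = (arrow_mx R p b)^T *m Omega_mx R p *m arrow_mx R p b.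
Proof.
move=> gp; have [w wd] := row_last_ex b gp; have [l ld] := row_last_ex (~~ b) gp.
have [e1 e2] := row_rauzy gp wd ld; have [_ wl] := winner_loserP gp wd ld.
rewrite (arrow_mxE gp wd ld) [(_ + _)^T]linearD /= trmx1 trmx_delta mulmxDl mul1mx mulmxDr mulmx1.
have addE (M N : 'M[R]_d) i j : (M + N) i j = M i j + N i j by rewrite mxE.
apply/matrixP => i j; rewrite !(addE, mul_mx_deltaE, mul_deltaE).
rewrite !(Omega_crossing b) e1 e2 !enum_rankK crossing_insert //; first last.
- by move=> z; rewrite ld row_le.
- by move=> z; rewrite wd row_le.
- by move=> x y; exact: row_inj.
- by move=> x y; exact: row_inj.
rewrite crossing_self !eq_enum_val; ring.
Qed.

Lemma arrow_unit b p : arrow_mx R p b \in unitmx.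
Proof.
rewrite /arrow_mx; case: winner_loser => [[w l]|]; last exact: unitmx1.
rewrite /elem_mx; case: (eqVneq w l) => [->|wl].
  have : (1%:M + delta_mx (rk l) (rk l)) *m
      (1%:M - 2^-1 *: delta_mx (rk l) (rk l)) = 1%:M :> 'M[R]_d.
    rewrite mulmxDl mul1mx mulmxBr mulmx1 -scalemxAr mul_delta_mx.
    by apply/matrixP => i j; rewrite !mxE; lra.
  by move=> /mulmx1_unit[].
have : (1%:M + delta_mx (rk w) (rk l)) *m (1%:M - delta_mx (rk w) (rk l)) = 1%:M :> 'M[R]_d.
  rewrite mulmxDl mul1mx mulmxBr mulmx1 mul_delta_mx_0; last first.
    by rewrite (inj_eq (@enum_rank_inj A)) eq_sym.
  by rewrite subr0 subrK.
by move=> /mulmx1_unit[].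
Qed.

Lemma Theta_cat p s t : Theta R p (s ++ t) = Theta R p s *m Theta R (endpoint p s) t.
Proof. by elim: s p => [|b s IH] p /=; rewrite ?mul1mx // IH mulmxA. Qed.

Lemma Theta_unit p s : Theta R p s \in unitmx.
Proof.
by elim: s p => [|b s IH] p /=; rewrite ?unitmx1 // unitmx_mul arrow_unit IH.
Qed.

Lemma Omega_endpoint p s : good_perm p ->
  Omega_mx R (endpoint p s) = (Theta R p s)^T *m Omega_mx R p *m Theta R p s.
Proof.
elim: s p => [|b s IH] p gp /=; first by rewrite trmx1 mul1mx mulmx1.
rewrite IH ?Omega_rauzy; [|exact: gp|exact: good_rauzy].
by rewrite trmx_mul !mulmxA.
Qed.

(* On [H], where [u_x] is the pairing of [Om e_x] with [u], this is the
   transvection along [Om e_x]. *)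
Definition letter_mx p (s : R) x : 'M[R]_d :=
  1%:M + s *: (delta_mx (rk x) (rk x) *m Omega_mx R p).

Lemma letter_mxK p s x : letter_mx p s x *m letter_mx p (- s) x = 1%:M.
Proof.
rewrite /letter_mx; set D := delta_mx _ _ *m _.
have DD : D *m D = 0.
  apply/matrixP => i j; rewrite {1}/D -mulmxA mul_deltaE mxE big1 ?mulr0 ?mxE // => k _.
  by rewrite mul_deltaE; case: eqP => [->|_]; rewrite ?Omega_self ?mul0r ?mulr0.
rewrite mulmxDl mul1mx mulmxDr mulmx1 -scalemxAr -scalemxAl DD !scaler0 addr0.
by rewrite scaleNr subrK.
Qed.

Lemma mul_letter_mx p s x (u : 'rV[R]_d) :
  u *m letter_mx p s x = u + (s * u 0 (rk x)) *: row (rk x) (Omega_mx R p).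
Proof.
rewrite mulmxDr mulmx1 -scalemxAr -scalerA; congr (_ + _ *: _).
apply/rowP => j; rewrite mulmxA !mxE (bigD1 (rk x)) //= big1 => [|k kx].
  rewrite mxE (bigD1 (rk x)) //= big1 => [|l lx]; rewrite !mxE ?eqxx ?mulr1 ?addr0 //.
  by rewrite (negPf lx) mulr0.
rewrite mxE big1 ?mul0r // => l _; rewrite !mxE.
by rewrite (negPf kx) andbF mulr0.
Qed.

(** The losers of the first [j] operations are the letters that started in the last [j] positions of
    the moving row. They differ from [w], so the elementary matrices simply add up. *)
Lemma Theta_rotate b p w j : good_perm p -> row_of b p w = d ->
  (j <= d - row_of (~~ b) p w)%N -> Theta R p (nseq j b) =
  1%:M + \matrix_(i, k) ((i == rk w) && (d - j < row_of (~~ b) p (enum_val k))%N)%:R.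
Proof.
move=> gp wd; elim: j => [|j IH] hj.
  apply/matrixP => i k; rewrite /= [RHS]mxE [X in _ = _ + X]mxE subn0 ltnNge row_le //.
  by rewrite andbF addr0.
have [e1 e2] := endpoint_rotate gp wd (ltnW hj).
rewrite -addn1 nseqD Theta_cat IH ?(ltnW hj) //=.
have gj := good_endpoint (nseq j b) gp; have [l ld] := row_last_ex (~~ b) gj.
have wj : row_of b (endpoint p (nseq j b)) w = d by rewrite e1.
rewrite (arrow_mxE gj wj ld) mulmx1 mulmxDr mulmx1 -addrA; congr (_ + _).
have {}ld : rotate (row_of (~~ b) p) (row_of (~~ b) p w) j l = d :> nat by rewrite -e2.
have ml : row_of (~~ b) p l = (d - j)%N :> nat.
  move: ld (row_le (~~ b) l gp) hj; rewrite ffunE.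
  have [D DE] : exists D, D = d by exists d.
  rewrite -!DE; move: (row_of (~~ b) p) => m.
  by case: (leqP (m l) (m w)) => ?; case: (leqP (m l + j) D) => ?; lia.
have addE (M N : 'M[R]_d) i k : (M + N) i k = M i k + N i k by rewrite mxE.
apply/matrixP => i k; rewrite addE mul_mx_deltaE addE !mxE enum_rankK.
have -> : (d - j < row_of (~~ b) p w)%N = false by lia.
rewrite andbF addr0 -eq_enum_val -natrM -natrD; congr _%:R.
have jd : (d - (j + 1) < d - j)%N by lia.
have [->|kl] := eqVneq (enum_val k) l.
  by rewrite ml muln1 ltnn andbF jd andbT.
have step a : a <> (d - j)%N -> (d - (j + 1) < a)%N = (d - j < a)%N by lia.
rewrite muln0 addn0 step // -ml => /(row_inj gp) e; by rewrite e eqxx in kl.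
Qed.

(** In a full turn the losers are the letters to the right of [w] in the moving row; as [w] is last
    in the kept row, they are exactly those that cross [w]. *)
Lemma letter_loop b p w : good_perm p -> row_of b p w = d -> exists s,
  endpoint p s = p /\ Theta R p s = letter_mx p (side b) w.
Proof.
move=> gp wd; exists (nseq (d - row_of (~~ b) p w) b).
split; first exact: endpoint_full_rotate.
rewrite (Theta_rotate gp wd) // /letter_mx; congr (_ + _).
apply/matrixP => i k; rewrite mxE [RHS]mxE mul_deltaE (Omega_crossing b) enum_rankK.
rewrite mulrCA [side b * (side b * _)]mulrA.
have -> : side b * side b = 1 by rewrite /side; case: (b); ring.
rewrite mul1r -mulnb natrM; congr (_ * _).
rewrite subKn ?row_le // /crossing wd.
have -> : (d < row_of b p (enum_val k))%N = false by rewrite ltnNge row_le.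
have [->|kw] := eqVneq (enum_val k) w; first by rewrite wd !ltnn.
have -> : (row_of b p (enum_val k) < d)%N.
  rewrite ltn_neqAle row_le // andbT; apply: contraNneq kw => e.
  by apply/eqP/(row_inj (b := b) gp); rewrite e.
by rewrite /=; case: ltnP.
Qed.

(** The hypothesis says that column [x] of the path matrix is a unit column, as when [x] never
    loses. Combined with the change of Omega along the path, it carries the letter matrix from the
    endpoint back to [p]. *)
Lemma Theta_letter p s x c : good_perm p ->
  Theta R p s *m delta_mx (rk x) (rk x) = delta_mx (rk x) (rk x) ->
  Theta R p s *m letter_mx (endpoint p s) c x = letter_mx p c x *m Theta R p s.
Proof.
move=> gp Nx; rewrite /letter_mx mulmxDr mulmx1 mulmxDl mul1mx; congr (_ + _).
rewrite -scalemxAr -scalemxAl; congr (_ *: _).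
have := congr1 trmx Nx; rewrite trmx_mul trmx_delta => Nxt.
by rewrite (Omega_endpoint _ gp) !mulmxA Nx Nxt.
Qed.

(** The path is cut when [x] is last for the first time; before that, [x] cannot be a loser. *)
Lemma path_to_last p s x : good_perm p -> (exists b, row_of b (endpoint p s) x = d) ->
  exists t b, row_of b (endpoint p t) x = d /\
    Theta R p t *m delta_mx (rk x) (rk x) = delta_mx (rk x) (rk x).
Proof.
elim: s p => [|b s IH] p gp hs.
  by have [b hb] := hs; exists [::], b; split=> //; rewrite mul1mx.
have [[c hc]|nc] := pselect (exists c, row_of c p x = d).
  by exists [::], c; split=> //; rewrite mul1mx.
have [t [c [tc tx]]] := IH _ (good_rauzy b gp) hs.
exists (b :: t), c; split=> //=; rewrite -mulmxA tx.
have [w wd] := row_last_ex b gp; have [l ld] := row_last_ex (~~ b) gp.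
have lx : rk l != rk x.
  apply/eqP => /enum_rank_inj e; apply: nc; exists (~~ b); by rewrite -e.
by rewrite (arrow_mxE gp wd ld) mulmxDl mul1mx mul_delta_mx_0 // addr0.
Qed.

(** Go to a permutation where [x] is last and return, with or without a full turn there: the two
    loops differ by the letter matrix at [p]. *)
Lemma letter_quotient p x : good_perm p -> exists s t (c : R),
  [/\ rauzy_monoid p s, rauzy_monoid p t, c = 1 \/ c = -1 &
   Theta R p s = letter_mx p c x *m Theta R p t].
Proof.
move=> gp; have [s0 hs0] := exists_last x gp.
have [s [b [sx Nx]]] := path_to_last gp hs0.
have gq := good_endpoint s gp; have [l [el Tl]] := letter_loop gq sx.
have [r er] := path_return s gp.
exists (s ++ l ++ r), (s ++ r), (side b); split.
- by rewrite /rauzy_monoid !endpoint_cat el.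
- by rewrite /rauzy_monoid endpoint_cat.
- by rewrite /side; case: (b); [left|right].
by rewrite !Theta_cat el Tl !mulmxA (Theta_letter _ gp).
Qed.
End RauzyMatrices.

(** * From flags to frames, and from the monoid to the letter matrices *)

Section FromFlags.
Local Open Scope ring_scope.
Variables (R : realType) (A : finType) (p : rperm A).
Local Notation d := #|A|.
Local Notation Om := (Omega_mx R p).
Local Notation V := 'rV[R]_d.

Lemma mem_Hspace (u : V) : (u \in Hspace R p) = (u <= Om)%MS.
Proof.
apply/memv_imgP/idP => [[w _ ->]|/submxP[w ->]].
  by rewrite lfunE /= submxMl.
by exists w; rewrite ?memvf // lfunE.
Qed.

Lemma lag_frame_lagflag (b : 'I_(genus R p) -> V) : lag_frame Om b -> lagflag (Flag b).
Proof.
move=> lb; have [hb ib fb] := lb.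
have comb i u : u \in Flag b i -> exists c : 'rV_(genus R p), u = c *m frame_mx b.
  have /subvP sub : (Flag b i <= limg (linfun (mulmxr (frame_mx b))))%VS.
    apply: Flag_sub => j _; apply/memv_imgP; exists (delta_mx 0 j); first exact: memvf.
    by rewrite lfunE /= -rowE rowK.
  by move=> /sub /memv_imgP[c _ ->]; exists c; rewrite lfunE.
have FH i : (Flag b i <= Hspace R p)%VS by apply: Flag_sub => j _; rewrite mem_Hspace.
split=> // [i|i j|i u v ui vi]; [exact: dim_Flag | exact: FlagS |].
have hu : (u <= Om)%MS by rewrite -mem_Hspace (subvP (FH i)).
have [c uc] := comb _ _ ui; have [e ve] := comb _ _ vi.
change (sform Om u v = 0); rewrite ve mul_frame_mx om_sumr big1 // => j _.
rewrite (sform_skew (Omega_skew R p) (hb j) hu) uc mul_frame_mx om_sumr big1 ?oppr0 ?mulr0 //.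
by move=> k _; rewrite ib mulr0.
Qed.

Lemma lagflag_lag_frame (F : flag R p) : lagflag F -> exists2 b, lag_frame Om b & Flag b = F.
Proof.
move=> [dF mF hF iF]; have [b fb Fb] := flag_has_frame dF mF.
have bF i : b i \in F i by rewrite -Fb mem_Flag.
exists b => //; split=> // [i|i j].
  by rewrite -mem_Hspace (subvP (hF i)).
have [ij|ji] := leqP i j.
  by apply: (iF j) => //; exact: subvP (mF _ _ ij) _ (bF i).
by apply: (iF i) => //; exact: subvP (mF _ _ (ltnW ji)) _ (bF j).
Qed.

Lemma actM (M N : 'M[R]_d) (F : flag R p) : act (M *m N) F = act N (act M F).
Proof.
apply/ffunP => i; rewrite !ffunE -limg_comp; congr (_ @: _)%VS.
by apply/lfunP => u; rewrite comp_lfunE !lfunE /= mulmxA.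
Qed.

Lemma act1 (F : flag R p) : act 1%:M F = F.
Proof.
apply/ffunP => i; rewrite ffunE; rewrite -[RHS]lim1g; congr (_ @: _)%VS.
by apply/lfunP => u; rewrite !lfunE /= mulmx1.
Qed.

Lemma act_Flag M (b : 'I_(genus R p) -> V) : @act A R p M (Flag b) = Flag (fun i => b i *m M).
Proof.
rewrite /act Flag_lin; congr Flag; apply: funext => i /=.
by rewrite lfunE.
Qed.

Lemma act_inj M (F F' : flag R p) : M \in unitmx -> act M F = act M F' -> F = F'.
Proof. by move=> uM /(congr1 (act (invmx M))); rewrite -!actM mulmxV // !act1. Qed.

Lemma Omega_values i j : [\/ Om i j = 0, Om i j = 1 | Om i j = -1].
Proof.
rewrite (Omega_crossing R true) mul1r /crossing.
by do !case: ifP => _; [constructor 2 | constructor 3 | constructor 1].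
Qed.

Lemma Omega_connected (S : pred 'I_d) : good_perm p -> (exists i, S i) ->
  (forall i j, S i -> Om i j != 0 -> S j) -> forall i, S i.
Proof.
move=> gp [i Si] adj j; apply: contraT => Sj.
have [||s [t [Ss St cr]]] :=
  @good_cross A p (fun x => S (enum_rank x)) (enum_val i) (enum_val j) gp.
- by rewrite enum_valK.
- by rewrite enum_valK.
have st : s <> t by move=> e; case/negP: St; rewrite -e.
case/negP: St; apply: adj Ss _; rewrite (Omega_crossing R true) mul1r /crossing !enum_rankK /=.
have n1 : p.1 s <> p.1 t :> nat by move=> /(@row_inj A p true s t gp).
have n2 : p.2 s <> p.2 t :> nat by move=> /(@row_inj A p false s t gp).
do !case: ifP => ?; rewrite ?oppr_eq0 ?oner_eq0 //; exfalso; lia.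
Qed.

(** Since a loop maps [C] onto [C] and acts injectively, its inverse also preserves [C]; so does the
    quotient of two loops. Exchanging the loops gives the other sign. *)
Lemma letter_invariant (C : flag R p -> Prop) x (e : R) F :
  good_perm p -> (forall s, rauzy_monoid p s ->
    forall F, C F <-> exists F', C F' /\ F = act (Theta R p s) F') ->
  e = 1 \/ e = -1 -> C F -> C (act (letter_mx p e x) F).
Proof.
move=> gp invC he CF.
have [s [t [c [ps pt hc est]]]] := letter_quotient R x gp.
have push r : rauzy_monoid p r -> C (act (Theta R p r) F).
  by move=> pr; apply/(invC r pr); exists F.
have [ec|ec] : e = c \/ e = - c.
    case: he hc => -> [->|->]; rewrite ?opprK; by [left|right].
- have /(invC t pt)[F' [CF' eF]] := push s ps.
  by have -> : act (letter_mx p e x) F = F'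
    by apply: (act_inj (Theta_unit R p t)); rewrite -eF -actM est ec.
- have /(invC s ps)[F' [CF' eF]] := push t pt.
  have -> : act (letter_mx p e x) F = F' => //.
  apply: (act_inj (Theta_unit R p s)); rewrite -eF -actM est mulmxA ec.
  by rewrite -{2}(opprK c) letter_mxK mul1mx.
Qed.
End FromFlags.

Theorem theorem5p1 (R : realType) (A : finType) (p : rperm A) :
  2 <= #|A| -> valid_perm p -> irreducible p ->
  forall C : flag R p -> Prop,
    (exists F, C F) ->
    (forall F, C F -> lagflag F) ->
    lag_closed C ->
    (forall s, rauzy_monoid p s ->
       forall F, C F <-> exists F', C F' /\ F = act (Theta R p s) F') ->
    forall F, lagflag F -> C F.
Proof.
move=> d2 vp ip C [F0 CF0] lagC closedC invC F lF.
have gp : good_perm p by [].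
(* In genus 0 the only flag is the empty family. *)
have [i _|g0] := pickP (fun i : 'I_(genus R p) => true); last first.
  by suff -> : F = F0 by []; apply/ffunP => i; have := g0 i.
have g_gt0 : 0 < genus R p by exact: leq_ltn_trans (ltn_ord i).
pose i0 := Ordinal g_gt0.
have [b lb bF] := lagflag_lag_frame lF; have [b0 lb0 b0F] := lagflag_lag_frame (lagC _ CF0).
have skew := Omega_skew R p.
suff [_ CF] : frame_in (Omega_mx R p) C b by rewrite -bF.
apply: (frame_in_all (i0 := i0) skew _ _ _ _ _ (b := b0)) => //; last first.
- by split=> //; rewrite b0F.
- by move=> S; apply: Omega_connected.
(* Without an entry 1 or -1 the matrix of Omega would vanish, and the genus with it. *)
- apply: contrapT => no.
  have Om0 : Omega_mx R p = 0%R.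
    apply/matrixP => k l; rewrite [RHS]mxE.
    by have [//|e|e] := Omega_values R p k l; case: no; exists k, l; [left|right].
  by have := g_gt0; rewrite {1}/genus Om0 mxrank0.
- move=> k; split=> [|b' [lb' Cb']]; first exact: row_sub.
  have inv e : e = 1%R \/ e = (-1)%R ->
      frame_in (Omega_mx R p) C (transv (Omega_mx R p) (row k (Omega_mx R p)) e \o b').
    move=> he; split; first by apply: lag_frame_transv => //; exact: row_sub.
    have := letter_invariant (enum_val k) gp invC he Cb'; rewrite act_Flag.
    suff -> : (fun j => (b' j *m letter_mx p e (enum_val k))%R) =
        transv (Omega_mx R p) (row k (Omega_mx R p)) e \o b' by [].
    apply: funext => j /=; have [hb' _ _] := lb'.
    by rewrite mul_letter_mx enum_valK /transv om_row.
  by split; apply: inv; [left|right].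
- move=> bs b' Cbs lb' cvg_bs; split=> //.
  apply: (closedC (fun k => Flag (bs k))) => [k||]; first by have [] := Cbs k.
    exact: lag_frame_lagflag.
  exists bs, b'; split=> [k|j|j l]; try by rewrite /frame => *; rewrite ffunE.
  exact: cvg_bs.
Qed.
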